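(* For any algebraic number $\alpha \in (0,1)$, the following conditions are equivalent. (1a) $M_\alpha$ is a simple antimatter monoid (that is, $M_\alpha$ is simple and antimatter). (1b) $\alpha^{-1}$ is a Perron number with no positive conjugate aside from itself. (1c) There exists a simple polynomial $n(x) \in x\mathbb{N}_0[x]-1$ satisfying $n(\alpha) = 0$. (1d) $M_\alpha$ is a valuation monoid. (1e) $M_\alpha$ is a simple GCD monoid (that is, $M_\alpha$ is simple and a GCD monoid). For any algebraic number $\alpha \in (0,1)$, the following conditions are also equivalent. (2a) $M_\alpha$ is an antimatter monoid. (2b) The simplified polynomial of $r_\alpha(x)$ has a root that is a Perron number and $\alpha$ has no positive conjugate aside from itself. (2c) There exists a polynomial $n(x) \in x\mathbb{N}_0[x]-1$ satisfying $n(\alpha)=0$. (2d) $M_\alpha$ is (isomorphic to) a direct product of valuation monoids; in particular, if $n = \gcd(\operatorname{supp} m_\alpha(x))$, then $M_{\alpha^n}$ is a valuation monoid and $M_\alpha \cong M_{\alpha^n}^n$ (the direct product of $n$ copies of $M_{\alpha^n}$). (2e) $M_\alpha$ is a GCD monoid.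
   Context: $\mathbb{N} = \{1,2,\dots\}$, $\mathbb{N}_0 = \mathbb{N}\cup\{0\}$; $\mathbb{N}_0[x]$ is the set of polynomials with nonnegative integer coefficients, and $x\mathbb{N}_0[x]-1 := \{x f(x) - 1 : f(x) \in \mathbb{N}_0[x]\}$. For $\alpha \in \mathbb{C}$, $M_\alpha := \{p(\alpha) : p(x) \in \mathbb{N}_0[x]\}$, viewed as a (cancellative commutative) monoid under addition. For an additively written monoid $M$ and $a,b \in M$, $b \mid_M a$ means $a = b + c$ for some $c \in M$. $M$ is a valuation monoid if for all $a,b \in M$ either $a \mid_M b$ or $b \mid_M a$. A greatest common divisor (GCD) of a nonempty subset $S \subseteq M$ is an element $g \in M$ with $g \mid_M s$ for all $s \in S$ and such that every $d\in M$ with $d \mid_M s$ for all $s \in S$ satisfies $d \mid_M g$; $M$ is a GCD monoid if every nonempty finite subset of $M$ has a GCD in $M$. An atom of $M$ is a non-invertible element $a \in M$ such that $a = b+c$ with $b,c \in M$ implies that $b$ or $c$ is invertible; $M$ is antimatter if it has no atoms. $m_\alpha(x) \in \mathbb{Q}[x]$ is the minimal polynomial of $\alpha$, of degree $d$, and $r_\alpha(x) := x^d m_\alpha(1/x)$. The support $\operatorname{supp} f(x)$ is the set of exponents occurring in $f(x)$ with nonzero coefficient. A nonconstant polynomial $f(x) \in \mathbb{Q}[x]$ is simple if the only pair $(n,g(x)) \in \mathbb{N} \times \mathbb{Q}[x]$ with $f(x) = g(x^n)$ is $(1,f(x))$; the simplified polynomial of $f(x)$ is the unique simple $g(x) \in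 \mathbb{Q}[x]$ with $f(x) = g(x^n)$ for some $n \in \mathbb{N}$. For algebraic $\alpha$, the monoid $M_\alpha$ is called simple if $m_\alpha(x)$ is simple. A Perron number is a real algebraic integer greater than $1$ that strictly exceeds each of its other algebraic conjugates (over $\mathbb{Q}$) in absolute value. *)

(* Defs.v *)
From HB Require Import structures.
From mathcomp Require Import all_boot all_order all_algebra all_field.
From mathcomp Require Import boolp classical_sets functions cardinality.

Set Implicit Arguments.
Unset Strict Implicit.
Unset Printing Implicit Defensive.

Import Order.TTheory GRing.Theory Num.Theory.

Local Open Scope classical_set_scope.
Local Open Scope ring_scope.

Section Monoids.
Variable M : nmodType.
Implicit Types (a b c d g : M) (S : set M).

Definition mdvd b a := exists c, a = b + c.

Definition minvertible a := exists b, a + b = 0.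

Definition matom a :=
  ~ minvertible a /\ forall b c, a = b + c -> minvertible b \/ minvertible c.

Definition antimatter := ~ exists a, matom a.

Definition valuation_monoid := forall a b, mdvd a b \/ mdvd b a.

Definition is_mgcd S g :=
  (forall s, S s -> mdvd g s) /\
  (forall d, (forall s, S s -> mdvd d s) -> mdvd d g).

Definition gcd_monoid :=
  forall S, finite_set S -> S !=set0 -> exists g, is_mgcd S g.

End Monoids.

(* M is isomorphic to the direct product of the N i, with componentwise       *)
(* addition. The product is the plain dependent function type: it carries no  *)
(* nmodType instance for an arbitrary index type, so additivity of the        *)
(* bijection f is required of each of its components.                         *)
Definition isom_dprod (M : nmodType) (I : Type) (N : I -> nmodType) :=
  exists f : M -> forall i, N i,
    bijective f /\ forall i, nmod_morphism (fun x => f x i).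

Definition natpoly (R : nzSemiRingType) (p : {poly nat}) : {poly R} :=
  map_poly (GRing.natmul 1) p.
Arguments natpoly R p : clear implicits.

Definition Mpred (alpha : algC) : {pred algC} :=
  fun x => `[< exists p : {poly nat}, x = (natpoly algC p).[alpha] >].

Fact Mpred_nmod_closed alpha : Algebra.nmod_closed (Mpred alpha).
Proof.
split=> [|_ _ /asboolP[p ->] /asboolP[q ->]]; apply/asboolP.
  by exists 0; rewrite /natpoly rmorph0 horner0.
by exists (p + q); rewrite /natpoly rmorphD hornerD.
Qed.
HB.instance Definition _ alpha :=
  GRing.isAddClosed.Build algC (Mpred alpha) (Mpred_nmod_closed alpha).

(* The monoid M_alpha, with the addition of algC. *)
Definition Mmon (alpha : algC) := {x : algC | x \in Mpred alpha}.
HB.instance Definition _ alpha := SubChoice.on (Mmon alpha).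
HB.instance Definition _ alpha :=
  GRing.SubChoice_isSubNmodule.Build algC (Mpred alpha) (Mmon alpha)
    (Mpred_nmod_closed alpha).

(* The library's minCpoly lives in {poly algC}; simplicity needs the minimal  *)
(* polynomial in Q[x].                                                        *)
Definition minpoly (alpha : algC) : {poly rat} := s2val (minCpolyP alpha).

Fact minCpolyE alpha : minCpoly alpha = map_poly ratr (minpoly alpha).
Proof. by rewrite /minpoly; case: minCpolyP => p []. Qed.

Fact root_minpoly alpha q :
  root (map_poly ratr q) alpha = (minpoly alpha %| q)%R.
Proof. by rewrite /minpoly; case: minCpolyP => p []. Qed.

Definition conjugate (alpha beta : algC) := root (minCpoly alpha) beta.

(* x ^ deg p * p(1/x) *)
Definition reciprocal (p : {poly rat}) : {poly rat} :=
  \poly_(i < size p) p`_((size p).-1 - i).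

Definition supp_gcd (p : {poly rat}) : nat :=
  \big[gcdn/0%N]_(i < size p | p`_i != 0) i.

Definition simple_poly (f : {poly rat}) :=
  (1 < size f)%N /\
  forall (n : nat) (g : {poly rat}),
    (0 < n)%N -> f = g \Po 'X^n -> n = 1%N /\ g = f.

(* g is the simplified polynomial of f. *)
Definition simplified (f g : {poly rat}) :=
  simple_poly g /\ exists n : nat, (0 < n)%N /\ f = g \Po 'X^n.

Definition simple_Mmon (alpha : algC) := simple_poly (minpoly alpha).

Definition in_xN0x_sub1 (p : {poly rat}) :=
  exists f : {poly nat}, p = 'X * natpoly rat f - 1.

Definition perron (beta : algC) :=
  [/\ beta \in Aint, 1 < beta &
      forall gamma, conjugate beta gamma -> gamma != beta -> `|gamma| < beta].

Definition no_other_positive_conjugate (alpha : algC) :=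
  forall beta, conjugate alpha beta -> 0 < beta -> beta = alpha.

(* Main.v *)
(* Antimatter means that 1 is not an atom, that is, alpha f(alpha) = 1 for some
   f in N_0[x]. If M_alpha is a GCD monoid where this fails, then all powers of
   alpha are atoms, hence primes, which an integer relation p(alpha) = q(alpha)
   with disjoint supports contradicts.

   If alpha f(alpha) = 1, then n = x f - 1 vanishes at all conjugates of alpha,
   so alpha is the only positive one and none is smaller in modulus; a conjugate
   of modulus alpha is alpha times a root of unity. When m_alpha is simple there
   is no such conjugate but alpha (Ferguson-Boyd), so b = 1/alpha is Perron.

   Conversely let b be Perron, without other positive conjugates, with minimal
   polynomial (x - b) S, and let w in Z[x] with w(b) > 0. As S has no root in
   [0, oo), some multiple S t has positive coefficients (Meissner). Modulo the
   minimal polynomial, x^D w is a positive multiple of b^D S t up to an error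
   o(b^D), so for large D it is congruent to a polynomial of fixed degree with
   large coefficients, which can be rounded to positive integers. The case w = 1
   gives n; general w shows that M_alpha contains every positive element of
   Z[alpha], whence the valuation property.

   When m_alpha = h(x^k), splitting polynomials by exponents mod k reduces
   everything to alpha^k, and yields M_alpha = M_(alpha^k)^k. *)

Require Import Defs.
From mathcomp Require Import all_boot all_order all_algebra all_field.
From mathcomp Require Import boolp classical_sets functions cardinality.
From mathcomp Require Import ring.

Set Implicit Arguments.
Unset Strict Implicit.
Unset Printing Implicit Defensive.

Import Order.TTheory GRing.Theory Num.Theory.
Local Open Scope ring_scope.

(** * Elementary bounds and interpolation *)

Lemma ler_sum_seq_term (R : numDomainType) (T : eqType) (s : seq T) (f : T -> R)
    (z : T) :
  (forall z, 0 <= f z) -> z \in s -> f z <= \sum_(y <- s) f y.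
Proof.
move=> f_ge0; elim: s => // y s IHs; rewrite inE big_cons => /predU1P[->|/IHs].
  by rewrite lerDl sumr_ge0.
by move/le_trans; apply; rewrite lerDr.
Qed.

(** Finitely many moduli below [b] leave a gap; asking for [1 <= r] keeps the powers of [r] at least
    1. *)
Lemma norm_bound_lt (R : numDomainType) (s : seq R) (b : R) :
  1 < b -> {in s, forall z, `|z| < b} ->
  exists2 r, 1 <= r < b & {in s, forall z, `|z| <= r}.
Proof.
move=> b_gt1; elim: s => [|y s IHs] lt_b; first by exists 1; rewrite ?lexx.
have [z zs|r /andP[r_ge1 r_ltb] le_r] := IHs.
  by apply: lt_b; rewrite inE zs orbT.
have r_real : r \is Num.real by rewrite ger0_real ?(le_trans _ r_ge1).
have [ley|lty] := real_leP (normr_real y) r_real.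
  by exists r; rewrite ?r_ge1 // => z; rewrite inE => /predU1P[->|/le_r].
exists `|y|.
  by rewrite lt_b ?mem_head // andbT (le_trans r_ge1 (ltW lty)).
by move=> z; rewrite inE => /predU1P[->|/le_r/le_trans->] //; rewrite ltW.
Qed.

Lemma exp_unbounded (R : archiNumFieldType) (q c : R) :
  1 < q -> 0 <= c -> exists n, forall m, (n <= m)%N -> c < q ^+ m.
Proof.
move=> q_gt1 c_ge0; have q1_gt0 : 0 < q - 1 by rewrite subr_gt0.
have bernoulli m : 1 + (q - 1) *+ m <= q ^+ m.
  elim: m => [|m IHm]; first by rewrite mulr0n addr0.
  rewrite exprS -{2}[q](subrK 1) mulrDl mul1r mulrS addrCA lerD //.
  by rewrite -[leLHS]mulr1 ler_wpM2l ?exprn_ege1 // ltW.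
exists (Num.bound (c / (q - 1))) => m le_m; apply: lt_le_trans (bernoulli m).
rewrite -ltrBlDl -mulr_natl; apply: lt_trans (_ : c < _); first by rewrite ltrBlDr ltrDl.
rewrite -ltr_pdivrMr //; apply: lt_le_trans (archi_boundP _) _.
  by rewrite divr_ge0 // ltW.
by rewrite ler_nat.
Qed.

Lemma size_factor_XsubC (R : idomainType) (p q : {poly R}) z :
  p = q * ('X - z%:P) -> size q = (size p).-1.
Proof.
move=> ->; have [->|q0] := eqVneq q 0; first by rewrite mul0r size_poly0.
by rewrite size_Mmonic ?monicXsubC // size_XsubC addn2.
Qed.

(* Newton interpolation, removing one node at a time. *)
Lemma interpolation_bound (F : numFieldType) (s : seq F) :
  uniq s -> exists2 C, 0 <= C &
    forall (E : {poly F}) r, (size E <= size s)%N ->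
      {in s, forall z, `|E.[z]| <= r} -> forall i, `|E`_i| <= C * r.
Proof.
elim: s => [_|z s IHs] /=.
  exists 0 => // E r; rewrite leqn0 size_poly_eq0 => /eqP-> _ i.
  by rewrite coef0 normr0 mul0r.
case/andP=> zNs /IHs[C C_ge0 boundC] {IHs}.
pose N := \sum_(y <- s) `|y - z|^-1.
have N_ge0 : 0 <= N by apply: sumr_ge0 => y _; rewrite invr_ge0.
(* Write E = E(z) + (X - z) G. At the other nodes y, |G(y)| = |E(y) - E(z)| / |y - z| <= 2 N r, so G
   has coefficients at most C (2 N r); the factor X - z contributes 1 + |z|. *)
exists (1 + (1 + `|z|) * (C * (2 * N))) => [|E r sizeE boundE i].
  by rewrite addr_ge0 ?mulr_ge0 ?addr_ge0.
have /factor_theorem[G defG] : root (E - E.[z]%:P) z.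
  by rewrite rootE !hornerE subrr.
have r_ge0 : 0 <= r by apply: le_trans (boundE z (mem_head _ _)).
have sizeG : (size G <= size s)%N.
  rewrite (size_factor_XsubC defG) -subn1 leq_subLR add1n.
  rewrite (leq_trans (size_polyD _ _)) // geq_max sizeE size_polyN.
  by rewrite (leq_trans (size_polyC_leq1 _)).
have boundG : {in s, forall y, `|G.[y]| <= 2 * N * r}.
  move=> y ys; have yz : y - z != 0.
    by rewrite subr_eq0; apply: contraNneq zNs => <-.
  have -> : G.[y] = (E.[y] - E.[z]) / (y - z).
    have /(congr1 (fun P : {poly F} => P.[y])) := defG.
    by rewrite !hornerE => ->; rewrite mulfK.
  rewrite normrM normfV mulrAC ler_pM ?invr_ge0 //.
    apply: le_trans (ler_normB _ _) _; rewrite mulr_natl mulr2n lerD ?boundE //.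
      by rewrite inE ys orbT.
    by rewrite mem_head.
  apply: (@ler_sum_seq_term _ _ s (fun y => `|y - z|^-1)) => // x.
  by rewrite invr_ge0.
have {}boundG := boundC G _ sizeG boundG.
have -> : E`_i = (E.[z]%:P)`_i + ((G * 'X)`_i - z * G`_i).
  by rewrite -coefCM -coefB -coefD mulrC -mulrBl mulrC -defG addrC subrK.
rewrite mulrDl mul1r (le_trans (ler_normD _ _)) // lerD //.
  by rewrite coefC; case: ifP => _; rewrite ?normr0 // boundE ?mem_head.
rewrite -!mulrA [2 * _]mulrA mulrDl mul1r (le_trans (ler_normB _ _)) // lerD //.
  rewrite coefMX; case: i => [|i] /=; last exact: boundG.
  by rewrite normr0 !mulr_ge0.
by rewrite normrM ler_wpM2l.
Qed.

(** * Multipliers with positive coefficients *)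

(** Inner zeros are excluded: with a positive smallest coefficient, a large multiple of [p] absorbs
    any bounded error. *)
Definition coefs_gt0 (R : numDomainType) (p : {poly R}) :=
  p != 0 /\ forall i, (i < size p)%N -> 0 < p`_i.

Lemma coefs_gt0_nneg (R : numDomainType) (p : {poly R}) i :
  coefs_gt0 p -> 0 <= p`_i.
Proof.
case=> _ p_gt0; have [/p_gt0/ltW//|le_p] := ltnP i (size p).
by rewrite nth_default.
Qed.

Lemma coefs_gt0_horner (R : numDomainType) (p : {poly R}) x :
  coefs_gt0 p -> 0 < x -> 0 < p.[x].
Proof.
move=> p_pos x_gt0; case: (p_pos) => p0 p_gt0.
have lt_p : ((size p).-1 < size p)%N by rewrite prednK // size_poly_gt0.
rewrite horner_coef (bigD1 (Ordinal lt_p)) //= ltr_wpDr ?sumr_ge0 // => [i _|].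
  by rewrite mulr_ge0 ?coefs_gt0_nneg ?exprn_ge0 ?ltW.
by rewrite mulr_gt0 ?exprn_gt0 ?p_gt0.
Qed.

Lemma coefs_gt0M (R : numDomainType) (p q : {poly R}) :
  coefs_gt0 p -> coefs_gt0 q -> coefs_gt0 (p * q).
Proof.
move=> p_pos q_pos; case: (p_pos) (q_pos) => [p0 p_gt0] [q0 q_gt0].
split=> [|i]; first exact: mulf_neq0.
rewrite size_mul // => lt_i; rewrite coefM.
have szp : (0 < size p)%N by rewrite size_poly_gt0.
have szq : (0 < size q)%N by rewrite size_poly_gt0.
(* The term of index j = min(i, deg p) is positive: as i <= deg p + deg q, the index i - j is at
   most deg q. *)
have lt_j : (minn i (size p).-1 < i.+1)%N by rewrite ltnS geq_minl.
rewrite (bigD1 (Ordinal lt_j)) //= ltr_wpDr ?sumr_ge0 // => [j _|].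
  by rewrite mulr_ge0 ?coefs_gt0_nneg.
rewrite mulr_gt0 ?p_gt0 ?q_gt0 //; first by rewrite gtn_min prednK // leqnn orbT.
rewrite minnE; move: lt_i szp szq; case: (size p) => // m; case: (size q) => // n.
rewrite addnS /= !ltnS => lt_i _ _.
rewrite subKn ?leq_subr //.
by rewrite leq_subLR.
Qed.

Lemma coefs_gt0_cons (R : numDomainType) (s : seq R) :
  s != [::] -> all (fun x => 0 < x) s -> coefs_gt0 (Poly s).
Proof.
move=> s0 s_gt0; have szs : (0 < size s)%N by case: (s) s0.
have defs : Poly s = s :> seq R.
  apply: (@PolyK _ 0); case: s s0 s_gt0 {szs} => // x s _ /allP s_gt0 /=.
  by rewrite gt_eqF // s_gt0 // mem_last.
split=> [|i]; first by rewrite -size_poly_gt0 defs.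
by rewrite defs => lti; apply: (allP s_gt0); rewrite mem_nth.
Qed.

Lemma coefs_gt0_1 (R : numDomainType) : coefs_gt0 (1 : {poly R}).
Proof.
split=> [|i]; first exact: oner_neq0.
by rewrite size_poly1 ltnS leqn0 => /eqP->; rewrite coef1 ltr01.
Qed.

Lemma coefs_gt0_XD1 (R : numDomainType) : coefs_gt0 ('X + 1 : {poly R}).
Proof.
have -> : 'X + 1 = Poly [:: 1; 1] :> {poly R}.
  by rewrite /= !cons_poly_def mul0r add0r polyC1 mul1r.
by apply: coefs_gt0_cons; rewrite //= ltr01.
Qed.

(** With this sign, a is the sum and b the product of the two roots. *)
Definition quad (R : nzRingType) (a b : R) : {poly R} := 'X^2 - a%:P * 'X + b%:P.

Lemma quadE (R : nzRingType) (a b : R) : quad a b = Poly [:: b; - a; 1].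
Proof.
apply/polyP=> i; rewrite coefD coefB coefCM coefXn coefX coefC coef_Poly.
case: i => [|[|[|i]]] /=; last by rewrite nth_nil mulr0 subr0 addr0.
- by rewrite mulr0 subr0 add0r.
- by rewrite mulr1 sub0r addr0.
by rewrite mulr0 subr0 addr0.
Qed.

(** The factor x + 1 fills the odd gaps of p(x^2): the coefficients 2j and 2j + 1 of the product
    both equal that of x^j in p. *)
Lemma coefs_gt0_comp_X2 (R : numDomainType) (p : {poly R}) :
  coefs_gt0 p -> coefs_gt0 ((p \Po 'X^2) * ('X + 1)).
Proof.
move=> p_pos; case: (p_pos) => p0 p_gt0.
have szp : (0 < size p)%N by rewrite size_poly_gt0.
have p2_0 : p \Po 'X^2 != 0 by rewrite comp_poly_eq0 ?size_polyXn.
have X1_0 : 'X + 1 != 0 :> {poly R} by rewrite -size_poly_gt0 -polyC1 size_XaddC.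
split=> [|i]; first exact: mulf_neq0.
have sz2 : (size (p \Po 'X^2)).-1 = ((size p).-1 * 2)%N.
  by rewrite size_comp_poly size_polyXn.
have {sz2}sz2 : size (p \Po 'X^2) = ((size p).-1 * 2).+1.
  by rewrite -sz2 prednK // size_poly_gt0.
rewrite size_mul // -polyC1 size_XaddC sz2 addSn /= addn2 => lt_i.
have lt_half : (i./2 < size p)%N.
  rewrite -(prednK szp) ltnS; move: lt_i; rewrite ltnS muln2 => /half_leq.
  by rewrite -uphalfE uphalf_double.
have {lt_half} := p_gt0 _ lt_half.
rewrite polyC1 mulrDr mulr1 coefD coefMX !coef_comp_poly_Xn // !divn2 !dvdn2.
case: i lt_i => [|i] _ //=; first by rewrite add0r.
by case: (boolP (odd i)) => //= oi; rewrite ?add0r // addr0 uphalf_half (negPf oi).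
Qed.

(** The multiplier x + 1 takes care of a = 0, where the quadratic has a gap in the middle. *)
Lemma quad_nneg_multiplier (R : numDomainType) (a b : R) :
  a <= 0 -> 0 < b -> exists t, coefs_gt0 t /\ coefs_gt0 (quad a b * t).
Proof.
move=> a_le0 b_gt0; exists ('X + 1); split; first exact: coefs_gt0_XD1.
have -> : quad a b * ('X + 1) = Poly [:: b; b - a; 1 - a; 1].
  rewrite /= !cons_poly_def /quad mul0r add0r !polyCB polyC1 mul1r.
  ring.
apply: coefs_gt0_cons => //=.
by rewrite b_gt0 ltr01 !subr_gt0 !(le_lt_trans a_le0).
Qed.

(** Graeffe's root squaring: [quad (- a) b] is [quad a b] at -x, and the quadratic on the right has
    the squared roots. *)
Lemma quad_double (R : comNzRingType) (a b : R) :
  quad a b * quad (- a) b = quad (a ^+ 2 - 2 * b) (b ^+ 2) \Po 'X^2.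
Proof.
rewrite /quad comp_polyD comp_polyB !comp_polyM !comp_polyC !comp_polyX.
rewrite polyCB polyCN polyCM !polyC_exp.
ring.
Qed.

(* Passing from the roots to their squares doubles the argument, until the
   real part is nonpositive. *)
Lemma quad_double_multiplier (R : numDomainType) (a b : R) :
  0 < a -> 0 < b ->
  (exists t, coefs_gt0 t /\ coefs_gt0 (quad (a ^+ 2 - 2 * b) (b ^+ 2) * t)) ->
  exists t, coefs_gt0 t /\ coefs_gt0 (quad a b * t).
Proof.
move=> a_gt0 b_gt0 [t [t_pos qt_pos]].
(* As a > 0, the cofactor [quad (- a) b] has positive coefficients itself. *)
exists (quad (- a) b * ((t \Po 'X^2) * ('X + 1))); split.
  apply: coefs_gt0M (coefs_gt0_comp_X2 t_pos).
  by rewrite quadE opprK; apply: coefs_gt0_cons; rewrite //= a_gt0 b_gt0 ltr01.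
by rewrite !mulrA quad_double -comp_polyM; apply: coefs_gt0_comp_X2.
Qed.

(* [4 b - a ^+ 2], scaled by [b], at least doubles at each squaring as long as
   [2 * b <= a ^+ 2]. *)
Lemma quad_multiplier_rec (R : numDomainType) k (a b : R) :
    a \is Num.real -> 0 < b -> 2 * b <= 2 ^+ k * (4 * b - a ^+ 2) ->
  exists t, coefs_gt0 t /\ coefs_gt0 (quad a b * t).
Proof.
elim: k a b => [|k IHk] a b a_real b_gt0 le_b.
  have [a_le0|a_gt0] := real_leP a_real (real0 R); first exact: quad_nneg_multiplier.
  (* For k = 0 the hypothesis reads a^2 <= 2 b: after one squaring the sum of the roots is
     nonpositive. *)
  apply: quad_double_multiplier => //.
  apply: quad_nneg_multiplier; last by rewrite exprn_gt0.
  rewrite subr_le0 -subr_ge0; move: le_b; rewrite mul1r -subr_ge0.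
  by congr (_ <= _); ring.
have [a_le0|a_gt0] := real_leP a_real (real0 R); first exact: quad_nneg_multiplier.
apply: quad_double_multiplier => //.
have c_real : a ^+ 2 - 2 * b \is Num.real.
  by rewrite rpredB ?rpredX // rpredM ?realn // gtr0_real.
have [c_le0|c_gt0] := real_leP c_real (real0 R).
  by apply: quad_nneg_multiplier; rewrite ?exprn_gt0.
apply: IHk; rewrite ?exprn_gt0 //.
have -> : 4 * b ^+ 2 - (a ^+ 2 - 2 * b) ^+ 2 = a ^+ 2 * (4 * b - a ^+ 2) by ring.
have d_ge0 : 0 <= 4 * b - a ^+ 2.
  rewrite -(pmulr_rge0 _ (_ : 0 < 2 ^+ k.+1)) ?exprn_gt0 ?ltr0n //.
  by apply: le_trans le_b; rewrite mulr_ge0 ?ler0n // ltW.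
apply: (@le_trans _ _ (b * (2 ^+ k.+1 * (4 * b - a ^+ 2)))).
  by rewrite expr2 mulrCA ler_wpM2l // ltW.
have -> : b * (2 ^+ k.+1 * (4 * b - a ^+ 2)) = 2 ^+ k * (2 * b * (4 * b - a ^+ 2)).
  by rewrite exprS; ring.
rewrite ler_wpM2l ?exprn_ge0 ?ler0n // ler_wpM2r //.
by rewrite -subr_ge0 ltW.
Qed.

(** Here 4 b - a^2 is (2 Im z)^2 > 0, so some power of 2 satisfies the hypothesis of
    [quad_multiplier_rec]. *)
Lemma quad_multiplier (z : algC) : z \isn't Num.real ->
  exists t, coefs_gt0 t /\ coefs_gt0 (quad (z + z^*) (z * z^*) * t).
Proof.
move=> zNR; have z0 : z != 0 by apply: contraNneq zNR => ->; rewrite real0.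
have b_gt0 : 0 < z * z^* by rewrite -normCK exprn_gt0 ?normr_gt0.
have a_real : z + z^* \is Num.real by rewrite CrealE rmorphD /= conjCK addrC.
have d_gt0 : 0 < 4 * (z * z^*) - (z + z^*) ^+ 2.
  have -> : 4 * (z * z^*) - (z + z^*) ^+ 2 = `|z - z^*| ^+ 2.
    by rewrite normCK rmorphB /= conjCK; ring.
  by rewrite exprn_gt0 // normr_gt0 subr_eq0 eq_sym -CrealE.
have [//||k le_k] := @exp_unbounded algC 2 (2 * (z * z^*) / (4 * (z * z^*) - (z + z^*) ^+ 2)).
- by rewrite (ltr_nat _ 1).
- by rewrite divr_ge0 ?ltW // mulr_gt0 ?ltr0n.
apply: (@quad_multiplier_rec _ k) => //.
by rewrite -ler_pdivrMr // ltW // le_k.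
Qed.

Lemma conj_stable_div (p q s : {poly algC}) :
  p != 0 -> map_poly Num.conj p = p -> map_poly Num.conj s = s -> s = q * p ->
  map_poly Num.conj q = q.
Proof.
move=> p0 pR sR defs; apply: (mulIf p0); rewrite -{1}pR -defs -[RHS]sR.
by rewrite defs rmorphM.
Qed.

Lemma conj_stable_root (s : {poly algC}) z :
  map_poly Num.conj s = s -> root s z -> root s z^*.
Proof. by move=> sR sz; rewrite -sR fmorph_root. Qed.

(* A weak form of Meissner's theorem. *)
Lemma positive_multiplier (s : {poly algC}) :
    s \is monic -> map_poly Num.conj s = s ->
    (forall z, root s z -> ~~ (0 <= z)) ->
  exists t, coefs_gt0 t /\ coefs_gt0 (s * t).
Proof.
have [n] := ubnP (size s); elim: n s => // n IHn s; rewrite ltnS => le_s s_mon sR.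
move=> s_root; have [sz1|sz1] := leqP (size s) 1.
  have -> : s = 1.
    have /monicP := s_mon; rewrite lead_coefE => lead1.
    rewrite (size1_polyC sz1) -[1 in RHS]polyC1 -lead1.
    by case: (size s) sz1 => [|[]].
  by exists 1; rewrite mulr1; split; apply: coefs_gt0_1.
have /closed_rootP[z sz] : size s != 1 by rewrite neq_ltn sz1 orbT.
(* It suffices to split off one real monic factor that has a multiplier: the quotient has one by
   induction, and the two multiply. *)
have step q (c : {poly algC}) : c \is monic -> (1 < size c)%N ->
    map_poly Num.conj c = c -> s = q * c ->
    (exists t, coefs_gt0 t /\ coefs_gt0 (c * t)) ->
  exists t, coefs_gt0 t /\ coefs_gt0 (s * t).
  move=> c_mon szc cR defs [t [t_pos ct_pos]].
  have q_mon : q \is monic by rewrite -(monicMr _ c_mon) -defs.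
  have [|//|||u [u_pos qu_pos]] := IHn q.
  - rewrite (leq_trans _ le_s) // defs size_Mmonic ?monic_neq0 //.
    by rewrite -subn1 -addnBA ?(ltnW szc) // -[X in (X < _)%N]addn0 ltn_add2l subn_gt0.
  - by apply: conj_stable_div defs; rewrite ?monic_neq0.
  - by move=> y qy; apply: s_root; rewrite defs rootM qy.
  exists (u * t); split; first exact: coefs_gt0M.
  by rewrite defs mulrACA; apply: coefs_gt0M.
have [zR|zNR] := boolP (z \is Num.real).
  have [q defs] := factor_theorem _ _ sz.
  apply: step defs _; rewrite ?monicXsubC ?size_XsubC //.
    by rewrite rmorphB /= map_polyX map_polyC /= (CrealP zR).
  have z_lt0 : z < 0.
    by have [/(negP (s_root z sz))//|//] := real_leP (real0 algC) zR.
  have -> : 'X - z%:P = Poly [:: - z; 1].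
    by rewrite /= !cons_poly_def mul0r add0r polyC1 mul1r polyCN.
  exists 1; rewrite mulr1; split; first exact: coefs_gt0_1.
  by apply: coefs_gt0_cons; rewrite //= oppr_gt0 z_lt0 ltr01.
(* A nonreal root and its conjugate together give a real quadratic factor. *)
have zJ : z^* != z by rewrite -CrealE.
have [q defs] := factor_theorem _ _ sz.
have /factor_theorem[r defq] : root q z^*.
  have := conj_stable_root sR sz; rewrite defs rootM root_XsubC (negPf zJ) orbF.
  by [].
have quadzE : ('X - z^*%:P) * ('X - z%:P) = quad (z + z^*) (z * z^*).
  by rewrite /quad polyCD polyCM; ring.
rewrite defq -mulrA quadzE in defs.
apply: step defs _; last exact: quad_multiplier.
- by rewrite -quadzE monicMr monicXsubC.
- by rewrite -quadzE size_Mmonic ?monicXsubC ?polyXsubC_eq0 // !size_XsubC.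
rewrite -quadzE rmorphM !rmorphB /= !map_polyX !map_polyC /= conjCK.
exact: mulrC.
Qed.

(** * Perron numbers without other positive conjugates *)

Lemma minpoly_monic alpha : minpoly alpha \is monic.
Proof. by rewrite -(map_monic (ratr : {rmorphism rat -> algC})) -minCpolyE minCpoly_monic. Qed.

Lemma size_minpoly alpha : (1 < size (minpoly alpha))%N.
Proof. by rewrite -(size_map_poly (ratr : {rmorphism rat -> algC})) -minCpolyE size_minCpoly. Qed.

Lemma minpoly_irreducible alpha : irreducible_poly (minpoly alpha).
Proof.
split=> [|q szq q_dvd]; first exact: size_minpoly.
have m0 : minpoly alpha != 0 by rewrite monic_neq0 ?minpoly_monic.
have [r defm] := dvdpP _ _ q_dvd.
have q0 : q != 0 by apply: contraNneq m0 => q0; rewrite defm q0 mulr0.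
have := root_minCpoly alpha; rewrite minCpolyE defm rmorphM rootM /= -defm.
rewrite !root_minpoly => /orP[m_dvd|m_dvd]; last by rewrite /eqp q_dvd.
have r0 : r != 0 by apply: contraNneq m0 => r0; rewrite defm r0 mul0r.
have := dvdp_leq r0 m_dvd; rewrite defm size_mul // -subn1.
rewrite leq_subLR [X in (_ <= X)%N]addnC leq_add2l.
by case: (size q) szq (size_poly_gt0 q) => [|[|n]] //; rewrite q0.
Qed.

Lemma conjugate_root alpha beta q :
  conjugate alpha beta -> root (map_poly ratr q) beta = (minpoly alpha %| q)%R.
Proof.
rewrite /conjugate minCpolyE => root_beta.
have [m_dvd|] := boolP (minpoly alpha %| q).
  by have [r ->] := dvdpP _ _ m_dvd; rewrite rmorphM rootM root_beta orbT.
rewrite -irreducible_poly_coprime; last exact: minpoly_irreducible.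
rewrite -(coprimep_map (ratr : {rmorphism rat -> algC})) => /coprimep_root/(_ root_beta).
by rewrite -rootE => /negPf.
Qed.

(** In characteristic 0 the derivative is nonzero of lower degree, hence coprime to the irreducible
    [minpoly alpha]. *)
Lemma separable_minCpoly alpha : separable_poly (minCpoly alpha).
Proof.
have m_irr := minpoly_irreducible alpha.
have m0 : minpoly alpha != 0 by rewrite monic_neq0 ?minpoly_monic.
rewrite minCpolyE separable_map unlock irreducible_poly_coprime //.
have d0 : (minpoly alpha)^`() != 0.
  apply/eqP=> /(congr1 (fun q : {poly rat} => q`_(size (minpoly alpha)).-2)) /eqP.
  have [n szn] : exists n, size (minpoly alpha) = n.+2.
    by exists (size (minpoly alpha)).-2; case: (size _) (size_minpoly alpha) => [|[]].
  rewrite szn coef0 coef_deriv /= mulrn_eq0 /=.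
  have /monicP := minpoly_monic alpha; rewrite lead_coefE szn => ->.
  by rewrite oner_eq0.
by apply/negP=> /(dvdp_leq d0); rewrite leqNgt lt_size_deriv.
Qed.

Lemma conjugate_neq0 alpha beta : alpha != 0 -> conjugate alpha beta -> beta != 0.
Proof.
move=> alpha0 cab; apply: contraNneq alpha0 => beta0.
have : root (map_poly ratr ('X : {poly rat})) beta by rewrite map_polyX rootE hornerX beta0.
by rewrite (conjugate_root _ cab) -root_minpoly map_polyX rootE hornerX.
Qed.

Lemma coef_natpoly (R : nzSemiRingType) (p : {poly nat}) i :
  (natpoly R p)`_i = (p`_i)%R%:R.
Proof. by rewrite coef_map_id0. Qed.

(** Controls the effect of rounding: the bound depends neither on the degree of [g] nor on i. *)
Lemma coef_mul_bound (R : numDomainType) (p g : {poly R}) :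
  (forall i, `|g`_i| <= 1) ->
  forall i, `|(p * g)`_i| <= \sum_(j < size p) `|p`_j|.
Proof.
move=> g_le1 i; rewrite -{1}[p]coefK poly_def mulr_suml coef_sum.
apply: le_trans (ler_norm_sum _ _ _) (ler_sum _ _) => j _.
rewrite -scalerAl coefZ coefXnM normrM ler_piMr //.
by case: ifP => _; rewrite ?normr0 ?ler01.
Qed.

(** Divided by b^D, the equation writes w(b) as a sum of powers of 1/b, with exponents at least 1
    because [size c <= D]. The last two clauses provide consecutive exponents, from which simplicity
    will follow. *)
Lemma perron_representation (b : algC) (w : {poly int}) :
    perron b -> no_other_positive_conjugate b -> 0 < (map_poly intr w).[b] ->
  exists D, exists c : {poly nat},
    [/\ (size c <= D)%N, (natpoly algC c).[b] = b ^+ D * (map_poly intr w).[b],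
        (0 < (c`_0)%R)%N & (0 < (c`_1)%R)%N].
Proof.
case=> b_int b_gt1 b_max b_pos wb_gt0.
have b_gt0 : 0 < b := lt_trans ltr01 b_gt1.
have bR : b \is Num.real by rewrite gtr0_real.
set p := minCpoly b.
have p_mon : p \is monic := minCpoly_monic b.
have [pZ defpZ] := floorpP b_int; rewrite -/p in defpZ.
have pZ_mon : pZ \is monic.
  have := p_mon; rewrite defpZ !monicE lead_coef_map_inj //; last exact: intr_inj.
  by rewrite -(inj_eq (intr_inj : injective (intr : int -> algC))).
have pR : map_poly Num.conj p = p.
  by rewrite defpZ -map_poly_comp; apply: eq_map_poly => x /=; rewrite rmorph_int.
have [rs defp] := closed_field_poly_normal p.
rewrite (monicP p_mon) scale1r in defp.
have rs_uniq : uniq rs by rewrite -separable_prod_XsubC -defp separable_minCpoly.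
have rsP z : (z \in rs) = root p z by rewrite defp root_prod_XsubC.
have b_rs : b \in rs by rewrite rsP root_minCpoly.
pose rs' := rem b rs.
have rs'P z : (z \in rs') = (z != b) && root p z by rewrite mem_rem_uniq // !inE rsP.
pose S : {poly algC} := \prod_(z <- rs') ('X - z%:P).
have defpS : p = S * ('X - b%:P).
  by rewrite defp (perm_big _ (perm_to_rem b_rs)) big_cons mulrC.
have S_mon : S \is monic by rewrite monic_prod_XsubC.
have S_root z : root S z = (z \in rs') by rewrite root_prod_XsubC.
have SR : map_poly Num.conj S = S.
  apply: conj_stable_div defpS; rewrite ?polyXsubC_eq0 //.
  by rewrite rmorphB /= map_polyX map_polyC /= (CrealP bR).
have [|t0 [t0_pos St0_pos]] := positive_multiplier S_mon SR.
  move=> z; rewrite S_root rs'P => /andP[zb pz]; rewrite le_eqVlt negb_or eq_sym.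
  rewrite (conjugate_neq0 _ pz) ?gt_eqF //=.
  by apply: contraNN zb => z_gt0; rewrite (b_pos z).
(* The extra factor x + 1 gives F degree at least 1 even if S and t0 are constant, so that c has
   both coefficients 0 and 1. *)
pose t := t0 * ('X + 1).
have t_pos : coefs_gt0 t by apply: coefs_gt0M (coefs_gt0_XD1 _).
pose F := S * t.
have F_pos : coefs_gt0 F by rewrite /F /t mulrA; apply: coefs_gt0M (coefs_gt0_XD1 _).
have [F0 F_gt0] := F_pos.
have Fb_gt0 : 0 < F.[b] by apply: coefs_gt0_horner.
have tb_gt0 : 0 < t.[b] by apply: coefs_gt0_horner.
have FbE : F.[b] = S.[b] * t.[b] by rewrite hornerM.
have Sb0 : S.[b] != 0.
  by apply: contraTneq Fb_gt0 => Sb0; rewrite FbE Sb0 mul0r ltxx.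
have [t0_0 _] := t0_pos; have [t_0 _] := t_pos.
have szt : (1 < size t)%N.
  rewrite /t -polyC1 size_Mmonic ?monicXaddC // size_XaddC addn2 /=.
  by rewrite ltnS size_poly_gt0.
have szF : size F = (size S + size t).-1 by rewrite size_mul // monic_neq0.
have szS : (0 < size S)%N by rewrite size_poly_gt0 monic_neq0.
have szF2 : (1 < size F)%N.
  by rewrite szF -subn1 ltn_subRL (leq_add szS szt).
have [C C_ge0 interp] := interpolation_bound rs_uniq.
have [|r /andP[r_ge1 r_ltb] le_r] := @norm_bound_lt _ rs' b b_gt1.
  by move=> z; rewrite rs'P => /andP[zb pz]; apply: b_max.
have r_gt0 : 0 < r := lt_le_trans ltr01 r_ge1.
pose W := \sum_(z <- rs) `|(map_poly intr w).[z]|.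
have W_ge0 : 0 <= W by apply: sumr_ge0.
have W_max z : z \in rs -> `|(map_poly intr w).[z]| <= W.
  by move=> zrs; apply: (@ler_sum_seq_term _ _ rs (fun z => `|(map_poly intr w).[z]|)).
(* The inverse of M is a lower bound for all coefficients of F. *)
pose M := \sum_(x <- F) `|x|^-1.
have M_max i : (i < size F)%N -> (F`_i)^-1 <= M.
  move=> lti; rewrite -[F`_i]gtr0_norm ?F_gt0 //.
  apply: (@ler_sum_seq_term _ _ F (fun x => `|x|^-1)); last exact: mem_nth.
  by move=> x; rewrite invr_ge0.
have M_gt0 : 0 < M.
  have lt0 := ltnW szF2; apply: lt_le_trans (M_max 0%N lt0).
  by rewrite invr_gt0 F_gt0.
have M_min i : (i < size F)%N -> M^-1 <= F`_i.
  by move=> lti; rewrite -[F`_i]invrK lef_pV2 ?posrE ?invr_gt0 ?F_gt0 ?M_max.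
pose B := \sum_(j < size p) `|p`_j|.
have B_ge0 : 0 <= B by apply: sumr_ge0.
(* Thus b^D k bounds from below the coefficients of the main term (A / F(b)) F defined below. *)
pose k := (map_poly intr w).[b] / F.[b] / M.
have k_gt0 : 0 < k by rewrite !divr_gt0.
have [||n n_max] := @exp_unbounded algC (b / r) ((B + C * W) / k).
- by rewrite ltr_pdivlMr // mul1r.
- by rewrite divr_ge0 ?(ltW k_gt0) // addr_ge0 ?mulr_ge0.
(* D >= n makes b^D k exceed both the rounding error B and the interpolation error of order r^D; D
   >= [size F] gives [size c <= D]. *)
pose D := maxn n (size F).
have {n_max} D_large : B + C * (r ^+ D * W) < b ^+ D * k.
  have := n_max D (leq_maxl _ _); rewrite ltr_pdivrMr // expr_div_n mulrAC.
  rewrite ltr_pdivlMr ?exprn_gt0 //; apply: le_lt_trans.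
  rewrite mulrDl; apply: lerD; last by rewrite [r ^+ D * W]mulrC mulrA.
  by rewrite ler_peMr // exprn_ege1.
pose A := b ^+ D * (map_poly intr w).[b].
have A_gt0 : 0 < A by rewrite mulr_gt0 ?exprn_gt0.
have := Pdiv.RingMonic.rdivp_eq pZ_mon (w * 'X^D).
set Q := Pdiv.CommonRing.rdivp _ _; set rm := Pdiv.CommonRing.rmodp _ _ => defrm.
have sz_rm : (size rm < size pZ)%N by by rewrite Pdiv.CommonRing.ltn_rmodp monic_neq0.
pose rm' : {poly algC} := map_poly intr rm.
have sz_rm' : (size rm' < size p)%N.
  by rewrite defpZ !size_map_inj_poly //; exact: intr_inj.
have rm'_root z : root p z -> rm'.[z] = z ^+ D * (map_poly intr w).[z].
  move=> /eqP pz.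
  have /(congr1 (fun q : {poly int} => (map_poly intr q : {poly algC}).[z])) := defrm.
  rewrite rmorphD !rmorphM /= map_polyXn !hornerE -defpZ pz mulr0 add0r => <-.
  by rewrite mulrC.
(* The subtracted polynomial takes the value A at b and 0 at the other roots of p. So E vanishes at
   b and is at most r^D W at the others, and interpolation makes its coefficients small. *)
pose E := rm' - (A / S.[b]) *: S.
have sz_p : size p = (size S).+1.
  by rewrite (size_factor_XsubC defpS) prednK // size_poly_gt0 monic_neq0.
have sz_rs : size rs = size S.
  by apply: succn_inj; rewrite -sz_p defp size_prod_XsubC.
have szE : (size E <= size S)%N.
  rewrite (leq_trans (size_polyD _ _)) // geq_max -ltnS -sz_p sz_rm' size_polyN.
  exact: size_scale_leq.
have E_vals : {in rs, forall z, `|E.[z]| <= r ^+ D * W}.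
  move=> z zrs; have [->|zb] := eqVneq z b.
    rewrite hornerD hornerN hornerZ rm'_root ?root_minCpoly // divfK // subrr normr0.
    by rewrite mulr_ge0 ?exprn_ge0 // ltW.
  have zrs' : z \in rs' by rewrite rs'P zb -rsP.
  have /eqP Sz : root S z by rewrite S_root.
  rewrite hornerD hornerN hornerZ Sz mulr0 subr0 rm'_root -?rsP //.
  by rewrite normrM normrX ler_pM ?exprn_ge0 ?W_max // lerXn2r ?nnegrE ?le_r // ltW.
have E_small : forall i, `|E`_i| <= C * (r ^+ D * W).
  by apply: interp => //; rewrite sz_rs.
(* Modulo p = S (X - b), S t is congruent to t(b) S; hence (A / S(b)) S can be traded for the
   positive polynomial (A / F(b)) F at the price of a multiple p u. *)
have [u1 defu1] : exists u1, t - (t.[b])%:P = u1 * ('X - b%:P).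
  by apply/factor_theorem; rewrite rootE !hornerE subrr.
pose a0 := A / F.[b].
have a0_gt0 : 0 < a0 by rewrite divr_gt0.
have tR : map_poly Num.conj t = t.
  apply/polyP=> i; rewrite coef_map /= conj_Creal // ger0_real //.
  exact: coefs_gt0_nneg.
have u1R : map_poly Num.conj u1 = u1.
  apply: conj_stable_div defu1; rewrite ?polyXsubC_eq0 //.
    by rewrite rmorphB /= map_polyX map_polyC /= (CrealP bR).
  by rewrite rmorphB /= map_polyC /= tR (conj_Creal (gtr0_real tb_gt0)).
pose u := a0 *: u1.
have uR i : u`_i \is Num.real.
  rewrite coefZ rpredM ?(gtr0_real a0_gt0) //; apply/CrealP.
  by rewrite -[in RHS]u1R coef_map.
(* Rounding u keeps the correction an integral multiple of [pZ]; the fractional part v changes each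
   coefficient by at most B. *)
pose u' : {poly int} := \poly_(i < size u) Num.floor u`_i.
have u'E i : u'`_i = Num.floor u`_i.
  rewrite coef_poly; case: ltnP => // le_u.
  by rewrite nth_default // floor0.
pose v := u - map_poly intr u'.
have v_bound i : `|v`_i| <= 1.
  have /andP[le_u lt_u] := real_floor_itv (uR i).
  rewrite coefB coef_map /= u'E ger0_norm ?subr_ge0 //.
  by rewrite lerBlDl -(intrD _ _ 1) ltW.
have szu : (size u <= (size t).-1)%N.
  rewrite (leq_trans (size_scale_leq _ _)) // (size_factor_XsubC defu1).
  rewrite -!subn1 leq_sub2r // (leq_trans (size_polyD _ _)) // geq_max leqnn.
  by rewrite size_polyN (leq_trans (size_polyC_leq1 _)) // ltnW.
have szv : (size v <= (size t).-1)%N.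
  rewrite (leq_trans (size_polyD _ _)) // geq_max szu size_polyN.
  by rewrite (leq_trans (size_poly _ _)) // (leq_trans (size_poly _ _)).
have sz_pv : (size (p * v)%R <= size F)%N.
  rewrite (leq_trans (size_polyMleq _ _)) // szF sz_p addSn /=.
  by rewrite -subn1 -addnBA ?(ltnW szt) // subn1 leq_add2l.
(* This integral polynomial is congruent to x^D w modulo [pZ] and equals a0 F up to the errors E and
   p v, which a0 F dominates. *)
pose cZ : {poly int} := rm + pZ * u'.
have cZE : map_poly intr cZ = E + a0 *: F - p * v.
  rewrite rmorphD rmorphM /= -defpZ -/rm' /v mulrBr.
  have -> : p * u = a0 *: F - (A / S.[b]) *: S.
    rewrite /u -scalerAr defpS -mulrA [_ * u1]mulrC -defu1 mulrBr scalerBr.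
    congr (_ - _); rewrite mulrC mul_polyC scalerA; congr (_ *: _).
    by rewrite /a0 FbE invfM mulrA divfK // gt_eqF.
  by rewrite /E; ring.
clearbody E v.
have cZ_gt0 i : (i < size F)%N -> 0 < cZ`_i.
  move=> lti; rewrite -(ltr0z algC) -coef_map /= cZE coefB coefD coefZ.
  have pv_small := coef_mul_bound p v_bound i.
  have ER : E`_i + a0 * F`_i - (p * v)`_i \is Num.real.
    have -> : E`_i + a0 * F`_i - (p * v)`_i = (E + a0 *: F - p * v)`_i.
      by rewrite coefB coefD coefZ.
    by rewrite -cZE coef_map /= realz.
  have lb : b ^+ D * k <= a0 * F`_i.
    rewrite /k /a0 /A !mulrA ler_wpM2l ?M_min // divr_ge0 ?(ltW Fb_gt0) //.
    exact: ltW.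
  have -> : E`_i + a0 * F`_i - (p * v)`_i = a0 * F`_i - ((p * v)`_i - E`_i) by ring.
  have dR : (p * v)`_i - E`_i \is Num.real.
    have -> : (p * v)`_i - E`_i = a0 * F`_i - (E`_i + a0 * F`_i - (p * v)`_i) by ring.
    by rewrite rpredB // rpredM ?gtr0_real ?F_gt0.
  rewrite subr_gt0 (le_lt_trans (real_ler_norm dR)) //.
  rewrite (le_lt_trans (ler_normB _ _)) // (lt_le_trans _ lb) //.
  by rewrite (le_lt_trans _ D_large) // lerD.
have cZ_size i : (size F <= i)%N -> cZ`_i = 0.
  move=> lei; apply: (@intr_inj algC); rewrite -coef_map /= cZE.
  rewrite coefB coefD coefZ [E`_i]nth_default; last first.
    rewrite (leq_trans szE) // (leq_trans _ lei) // szF -subn1 -addnBA ?(ltnW szt) //.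
    exact: leq_addr.
  by rewrite [F`_i]nth_default // [(p * v)`_i]nth_default ?(leq_trans sz_pv) // mulr0 addr0 subr0.
pose c : {poly nat} := \poly_(i < size F) `|(cZ`_i)%R|%N.
exists D, c; split.
- by rewrite (leq_trans (size_poly _ _)) // leq_maxr.
- have -> : natpoly algC c = map_poly intr cZ.
    apply/polyP=> i; rewrite coef_natpoly coef_poly coef_map /=.
    case: ltnP => [/cZ_gt0 c_gt0|/cZ_size-> //].
    by rewrite natr_absz gtr0_norm.
  rewrite rmorphD rmorphM /= -defpZ hornerD hornerM.
  by have /eqP-> := root_minCpoly b; rewrite mul0r addr0 rm'_root ?root_minCpoly.
- by rewrite coef_poly (ltnW szF2) absz_gt0 gt_eqF // cZ_gt0 // ltnW.
by rewrite coef_poly szF2 absz_gt0 gt_eqF // cZ_gt0.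
Qed.

(** * Minimal polynomials in a power of the variable *)

(** For k > 0, [size p] overestimates the length; the excess coefficients are zero. *)
Definition psect (R : nzSemiRingType) (k r : nat) (p : {poly R}) : {poly R} :=
  \poly_(j < size p) p`_(j * k + r).

Section Sections.
Variables (R : nzSemiRingType) (k : nat) (k_gt0 : (0 < k)%N).
Implicit Types p q : {poly R}.

Lemma coef_psect r p i : (psect k r p)`_i = p`_(i * k + r).
Proof.
rewrite coef_poly; case: ltnP => // lei; rewrite nth_default //.
by rewrite (leq_trans lei) // (leq_trans (leq_pmulr _ k_gt0)) // leq_addr.
Qed.

Lemma psect_split p : p = \sum_(r < k) 'X^r * (psect k r p \Po 'X^k).
Proof.
apply/polyP=> i; rewrite coef_sum.
have lt_r : (i %% k < k)%N by rewrite ltn_pmod.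
rewrite (bigD1 (Ordinal lt_r)) //= big1 ?addr0 => [|r /eqP r_neq].
  rewrite coefXnM ltnNge leq_mod /= coef_comp_poly_Xn //.
  have -> : (i - i %% k = i %/ k * k)%N by rewrite {1}(divn_eq i k) addnK.
  by rewrite dvdn_mull // mulnK // coef_psect -divn_eq.
rewrite coefXnM; case: ltnP => // le_r; rewrite coef_comp_poly_Xn //.
case: ifP => // /dvdnP[j defj]; case: r_neq; apply: val_inj => /=.
by rewrite -(subnK le_r) defj modnMDl modn_small.
Qed.

Lemma psect_comp p : psect k 0 (p \Po 'X^k) = p.
Proof.
by apply/polyP=> i; rewrite coef_psect addn0 coef_comp_poly_Xn // dvdn_mull // mulnK.
Qed.

Lemma comp_psect0 p :
  (forall i, p`_i != 0 -> (k %| i)%N) -> p = psect k 0 p \Po 'X^k.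
Proof.
move=> p_supp; apply/polyP=> i; rewrite coef_comp_poly_Xn // coef_psect addn0.
case: ifP => [/divnK-> //|/negP ndvd]; apply/eqP.
by have [//|/p_supp/ndvd] := eqVneq p`_i 0.
Qed.

Lemma coef_comp_Xn_dvdn p i : (p \Po 'X^k)`_i != 0 -> (k %| i)%N.
Proof. by rewrite coef_comp_poly_Xn //; case: ifP; rewrite ?eqxx. Qed.

End Sections.

(** Multiplying by a polynomial in x^k does not mix the exponent classes mod k. *)
Lemma psectM (R : comNzSemiRingType) k r (h q : {poly R}) : (r < k)%N ->
  psect k r ((h \Po 'X^k) * q) = h * psect k r q.
Proof.
move=> lt_rk; have k_gt0 : (0 < k)%N by apply: leq_trans lt_rk.
elim/poly_ind: h => [|h c IHh].
  by rewrite comp_poly0 !mul0r; apply/polyP=> i; rewrite coef_psect // !coef0.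
rewrite comp_polyD comp_polyM comp_polyX comp_polyC !mulrDl [h * 'X]mulrC.
rewrite -[in RHS]mulrA -IHh.
apply/polyP=> i; rewrite coef_psect // !coefD !coefCM coef_psect //; congr (_ + _).
rewrite [_ * 'X^k]mulrC -mulrA coefXnM coefXM; case: i => [|i] /=.
  by rewrite mul0n add0n lt_rk.
by rewrite coef_psect // mulSn -addnA ltnNge leq_addr /= addKn.
Qed.

Lemma psect_natpoly (R : nzSemiRingType) k r (p : {poly nat}) : (0 < k)%N ->
  psect k r (natpoly R p) = natpoly R (psect k r p).
Proof.
by move=> k_gt0; apply/polyP=> i; rewrite coef_natpoly !coef_psect // coef_natpoly.
Qed.

Lemma horner_comp_Xn (R : comNzSemiRingType) (p : {poly R}) k x :
  (p \Po 'X^k).[x] = p.[x ^+ k].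
Proof. by rewrite horner_comp hornerXn. Qed.

Lemma horner_ratr_comp_Xn (p : {poly rat}) k (x : algC) :
  (map_poly ratr (p \Po 'X^k)).[x] = (map_poly ratr p).[x ^+ k].
Proof. by rewrite map_comp_poly /= map_polyXn horner_comp_Xn. Qed.

Lemma minpoly_horner_eq0 alpha q :
  ((map_poly ratr q).[alpha] == 0) = (minpoly alpha %| q)%R.
Proof. exact: root_minpoly. Qed.

(** This is the linear independence of 1, alpha, ..., alpha^(k-1) over Q(alpha^k): a rational
    relation splits into one for each exponent class. *)
Lemma horner_psect alpha h k r q : (r < k)%N -> minpoly alpha = h \Po 'X^k ->
    (map_poly ratr q).[alpha] = 0 ->
  (map_poly ratr (psect k r q)).[alpha ^+ k] = 0.
Proof.
move=> lt_rk defm /eqP; rewrite minpoly_horner_eq0 => /dvdpP[s ->].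
rewrite mulrC defm psectM // rmorphM hornerM /= -horner_ratr_comp_Xn -defm.
by have /eqP := root_minCpoly alpha; rewrite minCpolyE => ->; rewrite mul0r.
Qed.

(** Both polynomials are monic and divide each other: h vanishes at alpha^k; conversely,
    substituting x^k in the minimal polynomial of alpha^k gives a multiple of h(x^k), and section 0
    descends this to a multiple of h. *)
Lemma minpoly_expn alpha h k : (0 < k)%N -> minpoly alpha = h \Po 'X^k ->
  minpoly (alpha ^+ k) = h.
Proof.
move=> k_gt0 defm.
have h_mon : h \is monic.
  have := minpoly_monic alpha; rewrite defm !monicE lead_coef_comp ?size_polyXn //.
  by rewrite lead_coefXn expr1n mulr1.
apply/eqP; rewrite -eqp_monic ?minpoly_monic // /eqp -minpoly_horner_eq0.
rewrite -horner_ratr_comp_Xn -defm.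
have /eqP := root_minCpoly alpha; rewrite minCpolyE => ->; rewrite eqxx /=.
have : (map_poly ratr (minpoly (alpha ^+ k) \Po 'X^k)).[alpha] == 0.
  by rewrite horner_ratr_comp_Xn minpoly_horner_eq0.
rewrite minpoly_horner_eq0 => /dvdpP[s /(congr1 (psect k 0))].
by rewrite psect_comp // mulrC defm psectM // => ->; rewrite dvdp_mulIl.
Qed.

Lemma simple_polyP (f : {poly rat}) :
  simple_poly f <-> (1 < size f)%N /\
    forall n, (0 < n)%N -> (forall i, f`_i != 0 -> (n %| i)%N) -> n = 1%N.
Proof.
split=> [[szf f_simple]|[szf f_simple]]; split=> // n.
  move=> n_gt0 /(comp_psect0 n_gt0) deff.
  by have [] := f_simple n _ n_gt0 deff.
move=> g n_gt0 deff; have n1 : n = 1%N.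
  by apply: f_simple => // i; rewrite deff; apply: coef_comp_Xn_dvdn.
by rewrite deff n1 expr1 comp_polyXr.
Qed.

Lemma supp_gcd_dvdn (f : {poly rat}) i : f`_i != 0 -> (supp_gcd f %| i)%N.
Proof.
move=> fi; have lti : (i < size f)%N.
  by rewrite ltnNge; apply: contraNN fi => lei; rewrite nth_default.
exact: (@biggcdn_inf _ (Ordinal lti)).
Qed.

Lemma dvdn_supp_gcd (f : {poly rat}) n :
  (forall i, f`_i != 0 -> (n %| i)%N) -> (n %| supp_gcd f)%N.
Proof. by move=> n_dvd; apply/dvdn_biggcdP => i; apply: n_dvd. Qed.

Lemma supp_gcd_gt0 (f : {poly rat}) : (1 < size f)%N -> (0 < supp_gcd f)%N.
Proof.
move=> szf; rewrite lt0n; apply/eqP=> k0.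
have : lead_coef f != 0 by rewrite lead_coef_eq0 -size_poly_gt0 ltnW.
rewrite lead_coefE => /supp_gcd_dvdn; rewrite k0 dvd0n.
by case: (size f) szf => [|[]].
Qed.

Lemma comp_supp_gcd (f : {poly rat}) (k := supp_gcd f) : (1 < size f)%N ->
  f = psect k 0 f \Po 'X^k /\ simple_poly (psect k 0 f).
Proof.
move=> szf; have k_gt0 : (0 < k)%N := supp_gcd_gt0 szf.
have deff : f = psect k 0 f \Po 'X^k by apply: comp_psect0 => // i; apply: supp_gcd_dvdn.
split=> //; apply/simple_polyP; split=> [|n n_gt0 n_dvd].
  rewrite ltnNge; apply/negP=> szh; move: szf.
  by rewrite deff [psect _ _ _]size1_polyC // comp_polyC ltnNge size_polyC_leq1.
(* If n divides all exponents of the section, then n k divides all exponents of f, hence their gcd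
   k. *)
have : (n * k %| k)%N.
  apply: dvdn_supp_gcd => i fi; have /divnK <- := supp_gcd_dvdn fi.
  rewrite dvdn_pmul2r //; apply: n_dvd.
  by rewrite coef_psect // addn0 divnK ?supp_gcd_dvdn.
rewrite -{2}[k]mul1n dvdn_pmul2r // dvdn1 => /eqP //.
Qed.

Lemma minpoly_coef0 (a : algC) : a != 0 -> (minpoly a)`_0 != 0.
Proof.
move=> a0; apply/eqP=> m0; have : conjugate a 0.
  by rewrite /conjugate minCpolyE rootE horner_coef0 coef_map /= m0 rmorph0.
by move/(conjugate_neq0 a0); rewrite eqxx.
Qed.

(* The conjugates of [a] over Q(a^D) have the form [a zeta] with [zeta ^ D = 1].
   Their product is real of modulus [a ^ m], where [m] is their number, and lies
   in Q(a^D), so every such [zeta] is an [m]-th root of unity; hence all [m]-th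
   roots of unity occur and the minimal polynomial is in [x ^ m]. *)
Lemma conjugate_circle_simple (a gamma : algC) D :
    0 < a -> simple_poly (minpoly a) -> (0 < D)%N -> conjugate a gamma ->
  gamma ^+ D = a ^+ D -> gamma = a.
Proof.
move=> a_gt0 a_simple D_gt0 gamma_conj gammaD.
have [Qs [QsC [s1 [defs1 _]]]] := num_field_exists [:: a].
case: s1 defs1 => [//|x [|//]] [] /= defx.
have QsCX n : QsC (x ^+ n) = a ^+ n by rewrite rmorphXn [QsC x]defx.
(* In a number field with a copy [x] of a, [mu] is the minimal polynomial over Q(a^D). It divides
   both [minCpoly a] and X^D - a^D, so its roots are conjugates of a with the same D-th power. *)
pose K := <<1%VS; x ^+ D>>%AS; pose mu := minPoly K x.
pose muC : {poly algC} := map_poly QsC mu.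
have QsC_alg (c : rat) : QsC (GRing.in_alg Qs c) = ratr c.
  exact: (fmorph_eq_rat (QsC \o GRing.in_alg Qs)).
have polyK (q : {poly rat}) : map_poly (GRing.in_alg Qs) q \is a polyOver K.
  apply/polyOverP=> i; rewrite coef_map /=; apply: (subvP (subv_adjoin _ _)).
  exact: rpredZ (mem1v _).
have map_alg (q : {poly rat}) : map_poly QsC (map_poly (GRing.in_alg Qs) q) = map_poly ratr q.
  by rewrite -map_poly_comp; apply: eq_map_poly => c /=; rewrite QsC_alg.
have mu_dvd (q : {poly Qs}) : q \is a polyOver K -> root q x -> muC %| map_poly QsC q.
  by move=> qK qx; rewrite dvdp_map minPoly_dvdp.
have mu_m : muC %| minCpoly a.
  rewrite minCpolyE -map_alg; apply: mu_dvd => //.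
  by rewrite -(fmorph_root QsC) map_alg defx -minCpolyE root_minCpoly.
have mu_D : muC %| 'X^D - (a ^+ D)%:P.
  have -> : 'X^D - (a ^+ D)%:P = map_poly QsC ('X^D - (x ^+ D)%:P).
    by rewrite rmorphB /= map_polyXn map_polyC -(QsCX D).
  apply: mu_dvd; last by rewrite rootE !hornerE subrr.
  by rewrite rpredB ?rpredX ?polyOverX // polyOverC memv_adjoin.
have [zs defmu] := closed_field_poly_normal muC.
have muC_mon : muC \is monic by rewrite map_monic monic_minPoly.
rewrite (monicP muC_mon) scale1r in defmu.
pose m := size zs.
have zs_uniq : uniq zs.
  by rewrite -separable_prod_XsubC -defmu (dvdp_separable mu_m) ?separable_minCpoly.
have zs_root z : z \in zs -> conjugate a z /\ z ^+ D = a ^+ D.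
  rewrite -root_prod_XsubC -defmu -dvdp_XsubCl => muz; split.
    by rewrite /conjugate -dvdp_XsubCl (dvdp_trans muz).
  have := dvdp_trans muz mu_D; rewrite dvdp_XsubCl rootE !hornerE subr_eq0.
  by move/eqP.
have norm_zs z : z ^+ D = a ^+ D -> `|z| = a.
  move=> zD; apply/eqP; rewrite -(eqrXn2 D_gt0) ?normr_ge0 ?(ltW a_gt0) //.
  by rewrite -normrX zD normrX ger0_norm // ltW.
have a_zs : a \in zs.
  by rewrite -root_prod_XsubC -defmu -defx fmorph_root root_minPoly.
have m_gt0 : (0 < m)%N by rewrite /m; case: (zs) a_zs.
have [q defq] : exists q : {poly rat}, muC`_0 = (map_poly ratr q).[a ^+ D].
  have /polyOverP/(_ 0%N)/Fadjoin_polyP[u /polyOver1P[q ->] defu] := minPolyOver K x.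
  exists q; rewrite coef_map /= defu -horner_map map_alg.
  by rewrite rmorphXn /= defx.
pose e := (map_poly ratr q).[a ^+ D].
have e_real : e \is Num.real.
  apply: rpred_horner; last by rewrite rpredX // gtr0_real.
  by apply/polyOverP=> i; rewrite coef_map /= CrealE fmorph_rat.
have e_norm : `|e| = a ^+ m.
  rewrite /e -defq -horner_coef0 defmu horner_prod normr_prod.
  rewrite (eq_big_seq (fun _ => a)) ?big_const_seq ?count_predT ?iter_mulr_1 //.
  by move=> z /zs_root[_ zD]; rewrite hornerXsubC sub0r normrN norm_zs.
(* Up to sign e = q(a^D) is a^m. This rational relation passes to the conjugate z, where q(z^D) is
   the same number e. *)
have exp_m z : conjugate a z -> z ^+ D = a ^+ D -> z ^+ m = a ^+ m.
  have [c [c0 ec]] : exists c : rat, c != 0 /\ e = ratr c * a ^+ m.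
    rewrite (realEsign e_real) e_norm; exists ((-1) ^+ (e < 0)%R).
    by rewrite signr_eq0 rmorphXn rmorphN1.
  move=> z_conj zD.
  have : (map_poly ratr ((q \Po 'X^D) - c *: 'X^m)).[a] == 0.
    rewrite rmorphB /= hornerD hornerN horner_ratr_comp_Xn map_polyZ /= map_polyXn.
    by rewrite hornerZ hornerXn -/e ec subrr.
  rewrite minpoly_horner_eq0 -(conjugate_root _ z_conj) rootE.
  rewrite rmorphB /= hornerD hornerN horner_ratr_comp_Xn map_polyZ /= map_polyXn.
  rewrite hornerZ hornerXn zD -/e ec -mulrBr mulf_eq0 fmorph_eq0 (negPf c0) /=.
  by rewrite subr_eq0 eq_sym => /eqP.
suff m1 : m = 1%N by rewrite -[gamma]expr1 -[a]expr1 -m1; apply: exp_m.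
(* As z^m = a^m for the m distinct roots z of [muC], [minpoly a] and G agree there. So G, of degree
   below m, is zero, and its constant coefficient shows that the part of [minpoly a] with exponents
   divisible by m vanishes at a. *)
pose G := \poly_(r < m) (map_poly ratr (psect m r (minpoly a))).[a ^+ m].
have G0 : G = 0.
  apply: roots_geq_poly_eq0 zs_uniq (size_poly _ _); apply/allP => z /zs_root[z_conj zD].
  rewrite rootE horner_poly; have := z_conj; rewrite /conjugate minCpolyE rootE.
  rewrite {1}(psect_split m_gt0 (minpoly a)) rmorph_sum horner_sum.
  congr (_ == _); apply: eq_bigr => r _.
  rewrite rmorphM hornerM /= map_polyXn hornerXn horner_ratr_comp_Xn exp_m //.
  exact: mulrC.
have h0_root : (map_poly ratr (psect m 0 (minpoly a) \Po 'X^m)).[a] == 0.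
  rewrite horner_ratr_comp_Xn; apply/eqP.
  by have /(congr1 (fun p : {poly algC} => p`_0)) := G0; rewrite coef_poly m_gt0 coef0.
have [szm m_supp] := (simple_polyP _).1 a_simple.
apply: m_supp => // i mi.
move: h0_root; rewrite minpoly_horner_eq0 => m_dvd.
(* This part is nonzero by its constant coefficient and no longer than [minpoly a], which divides
   it; hence they are associated. *)
pose h0 := psect m 0 (minpoly a) \Po 'X^m.
have h0E j : h0`_j = if (m %| j)%N then (minpoly a)`_j else 0.
  by rewrite coef_comp_poly_Xn // coef_psect // addn0; case: ifP => // /divnK->.
have h0_0 : h0 != 0.
  apply: contraTneq (minpoly_coef0 (lt0r_neq0 a_gt0)) => h0_0.
  by have := h0E 0%N; rewrite h0_0 coef0 dvdn0 => <-; rewrite eqxx.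
have : (size h0 <= size (minpoly a))%N.
  apply/leq_sizeP=> j lej; rewrite h0E; case: ifP => // _.
  exact: nth_default.
have le_h0 := dvdp_leq h0_0 m_dvd.
move=> ge_h0; have : minpoly a %= h0 by rewrite -dvdp_size_eqp // eqn_leq le_h0.
case/eqpP=> [[c1 c2] /= /andP[c1_0 c2_0]] /(congr1 (fun p : {poly rat} => p`_i)).
rewrite !coefZ h0E; case: ifP => // _; rewrite mulr0 => /eqP.
by rewrite mulf_eq0 (negPf c1_0) (negPf mi).
Qed.

(** * Reversed polynomials and inverses of conjugates *)

Definition revp (R : nzSemiRingType) (n : nat) (p : {poly R}) : {poly R} :=
  \poly_(i < n.+1) p`_(n - i).

Lemma horner_revp (F : fieldType) n (p : {poly F}) x : (size p <= n.+1)%N -> x != 0 ->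
  (revp n p).[x] = x ^+ n * p.[x^-1].
Proof.
move=> szp x0; rewrite horner_poly (horner_coef_wide _ szp) mulr_sumr.
rewrite (reindex_inj rev_ord_inj); apply: eq_bigr => i _ /=.
have le_in : (i <= n)%N by rewrite -ltnS.
rewrite subSS (subKn le_in) mulrCA exprVn; congr (_ * _).
by apply: (mulIf (expf_neq0 i x0)); rewrite -exprD subnK // divfK ?expf_neq0.
Qed.

Lemma revp_natpoly (R : nzSemiRingType) n (p : {poly nat}) :
  revp n (natpoly R p) = natpoly R (revp n p).
Proof.
apply/polyP=> i; rewrite coef_natpoly [LHS]coef_poly coef_natpoly coef_poly.
by case: ifP.
Qed.

Lemma revp_map (aR rR : nzRingType) (f : {rmorphism aR -> rR}) n (p : {poly aR}) :
  revp n (map_poly f p) = map_poly f (revp n p).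
Proof.
apply/polyP=> i; rewrite coef_map [LHS]coef_poly coef_map coef_poly /=.
by case: ifP; rewrite ?rmorph0.
Qed.

Lemma reciprocalE (p : {poly rat}) : p != 0 -> reciprocal p = revp (size p).-1 p.
Proof. by move=> p0; rewrite /reciprocal /revp prednK // size_poly_gt0. Qed.

Lemma root_reciprocal p (x : algC) : p != 0 -> x != 0 ->
  root (map_poly ratr (reciprocal p)) x = root (map_poly ratr p) x^-1.
Proof.
move=> p0 x0; rewrite reciprocalE // -revp_map /root horner_revp //.
  by rewrite mulf_eq0 expf_eq0 (negPf x0) andbF.
by rewrite size_map_poly prednK // size_poly_gt0.
Qed.

Lemma minpoly_neq0 alpha : minpoly alpha != 0.
Proof. by rewrite monic_neq0 ?minpoly_monic. Qed.

Lemma conjugateV (a gamma : algC) : a != 0 -> conjugate a^-1 gamma -> conjugate a gamma^-1.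
Proof.
move=> a0 conj_g; have g0 : gamma != 0 by apply: conjugate_neq0 conj_g; rewrite invr_eq0.
rewrite /conjugate minCpolyE -root_reciprocal ?minpoly_neq0 //.
rewrite (conjugate_root _ conj_g) -root_minpoly root_reciprocal ?minpoly_neq0 ?invr_eq0 //.
by rewrite invrK -minCpolyE root_minCpoly.
Qed.

(* The equation [n(alpha) = 0] for [n = x f - 1]. *)
Definition splits_one (alpha : algC) :=
  exists f : {poly nat}, alpha * (natpoly algC f).[alpha] = 1.

(** * Values of polynomials over the natural numbers, and the passage to Perron numbers *)

Lemma natpolyD (R : nzSemiRingType) p q : natpoly R (p + q) = natpoly R p + natpoly R q.
Proof. exact: rmorphD. Qed.

Lemma natpolyM (R : nzSemiRingType) p q : natpoly R (p * q) = natpoly R p * natpoly R q.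
Proof. exact: rmorphM. Qed.

Lemma natpoly0 (R : nzSemiRingType) : natpoly R 0 = 0.
Proof. exact: rmorph0. Qed.

Lemma natpoly1 (R : nzSemiRingType) : natpoly R 1 = 1.
Proof. exact: rmorph1. Qed.

Lemma natpoly_Xn (R : nzSemiRingType) n : natpoly R 'X^n = 'X^n.
Proof. by apply/polyP=> i; rewrite coef_natpoly !coefXn; case: eqP. Qed.

Lemma natpoly_neq0 (p : {poly nat}) : (natpoly algC p == 0) = (p == 0).
Proof.
apply/eqP/eqP=> [p0|->]; last by apply/polyP=> i; rewrite coef_natpoly !coef0.
apply/polyP=> i; apply/eqP; rewrite coef0 -(@pnatr_eq0 algC) -coef_natpoly.
by rewrite p0 coef0.
Qed.

Lemma horner_natpoly (p : {poly nat}) (x : algC) :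
  (natpoly algC p).[x] = \sum_(i < size p) (p`_i)%R%:R * x ^+ i.
Proof.
rewrite (@horner_coef_wide _ (size p)); last exact: size_poly.
by apply: eq_bigr => i _; rewrite coef_natpoly.
Qed.

Lemma natpoly_ge0 (p : {poly nat}) (x : algC) : 0 <= x -> 0 <= (natpoly algC p).[x].
Proof.
move=> x_ge0; rewrite horner_natpoly sumr_ge0 // => i _.
by rewrite mulr_ge0 ?exprn_ge0 ?ler0n.
Qed.

Lemma natpoly_ge_term (p : {poly nat}) i (x : algC) : 0 <= x -> p`_i != 0 ->
  x ^+ i <= (natpoly algC p).[x].
Proof.
move=> x_ge0 pi; have lti : (i < size p)%N.
  by rewrite ltnNge; apply: contraNN pi => lei; rewrite nth_default.
rewrite horner_natpoly (bigD1 (Ordinal lti)) //= -[leLHS]addr0 lerD //.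
  by rewrite ler_peMl ?exprn_ge0 // ler1n lt0n.
by rewrite sumr_ge0 // => j _; rewrite mulr_ge0 ?exprn_ge0 ?ler0n.
Qed.

Lemma natpoly_gt0 (p : {poly nat}) (x : algC) : 0 < x -> p != 0 ->
  0 < (natpoly algC p).[x].
Proof.
move=> x_gt0; rewrite -lead_coef_eq0 => /natpoly_ge_term le_x.
by rewrite (lt_le_trans _ (le_x _ (ltW x_gt0))) ?exprn_gt0.
Qed.

Lemma natpoly_le (p : {poly nat}) (x y : algC) : 0 <= x -> x <= y ->
  (natpoly algC p).[x] <= (natpoly algC p).[y].
Proof.
move=> x_ge0 le_xy; rewrite !horner_natpoly ler_sum // => i _.
by rewrite ler_wpM2l ?ler0n // lerXn2r ?nnegrE // (le_trans x_ge0).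
Qed.

Lemma natpoly_normr (p : {poly nat}) (x : algC) :
  `|(natpoly algC p).[x]| <= (natpoly algC p).[`|x|].
Proof.
rewrite !horner_natpoly (le_trans (ler_norm_sum _ _ _)) // ler_sum // => i _.
by rewrite normrM normrX normr_nat.
Qed.

(** The function x f(x) is increasing on the nonnegative reals. Only an inequality is asked of y, so
    that y may be the modulus of a conjugate. *)
Lemma splits_one_unique f (x y : algC) : 0 <= x -> 0 <= y ->
  x * (natpoly algC f).[x] = 1 -> 1 <= y * (natpoly algC f).[y] -> x <= y.
Proof.
move=> x_ge0 y_ge0 fx fy; have [//|lt_yx] := real_leP (ger0_real x_ge0) (ger0_real y_ge0).
have f_gt0 : 0 < (natpoly algC f).[x].
  rewrite lt0r natpoly_ge0 // andbT; apply/eqP=> f0.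
  by move/eqP: fx; rewrite f0 mulr0 eq_sym oner_eq0.
suff : y * (natpoly algC f).[y] < 1 by move/(le_lt_trans fy); rewrite ltxx.
rewrite -fx (le_lt_trans (_ : _ <= y * (natpoly algC f).[x])) ?ltr_pM2r //.
by rewrite ler_wpM2l // natpoly_le // ltW.
Qed.

Lemma map_ratr_natpoly (f : {poly nat}) :
  map_poly ratr (natpoly rat f) = natpoly algC f.
Proof. by apply/polyP=> i; rewrite coef_map /= !coef_natpoly rmorph_nat. Qed.

Lemma horner_xN0x_sub1 (f : {poly nat}) (x : algC) :
  (map_poly ratr ('X * natpoly rat f - 1)).[x] = x * (natpoly algC f).[x] - 1.
Proof.
by rewrite rmorphB rmorphM /= rmorph1 map_polyX map_ratr_natpoly !hornerE.
Qed.

Lemma splits_one_conjugate (a gamma : algC) f :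
  a * (natpoly algC f).[a] = 1 -> conjugate a gamma ->
  gamma * (natpoly algC f).[gamma] = 1.
Proof.
move=> fa conj_g; apply/eqP; rewrite -subr_eq0 -horner_xN0x_sub1 -rootE.
by rewrite (conjugate_root _ conj_g) -minpoly_horner_eq0 horner_xN0x_sub1 fa subrr.
Qed.

Lemma splits_one_neq0 f (x : algC) : x * (natpoly algC f).[x] = 1 -> f != 0.
Proof.
move=> fx; apply/eqP=> f0; move/eqP: fx.
by rewrite f0 natpoly0 horner0 mulr0 eq_sym oner_eq0.
Qed.

(** With n = [size f], dividing a f(a) = 1 by a^n gives the monic integral equation x^n = L(x) for
    1/a, where L reverses f and has degree below n. *)
Lemma splits_one_Aint a : a != 0 -> splits_one a -> a^-1 \in Aint.
Proof.
move=> a0 [f fa]; pose L : {poly algC} := natpoly algC (revp (size f).-1 f).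
have f0 := splits_one_neq0 fa.
have szf : (0 < size f)%N by rewrite size_poly_gt0.
have szL : (size L < size ('X^(size f) : {poly algC}))%N.
  rewrite size_polyXn ltnS (leq_trans (size_poly _ _)) //.
  by rewrite (leq_trans (size_poly _ _)) // prednK.
apply: (@root_monic_Aint ('X^(size f) - L)).
- rewrite rootE !hornerE subr_eq0 /L -revp_natpoly horner_revp ?invr_eq0 //; last first.
    by rewrite prednK // size_poly.
  rewrite invrK -{1}(prednK szf) exprS mulrC; apply/eqP; congr (_ * _).
  by rewrite -[LHS]mulr1 -fa mulKf.
- rewrite monicE lead_coefDl ?size_polyN //; first by rewrite lead_coefXn.
apply/polyOverP=> i; rewrite coefB coefXn coef_natpoly.
by rewrite rpredB // rpred_nat.
Qed.

Lemma splits_one_no_other_positive a : 0 < a -> splits_one a ->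
  no_other_positive_conjugate a.
Proof.
move=> a_gt0 [f fa] gamma conj_g gamma_gt0.
have fg := splits_one_conjugate fa conj_g.
have a_ge0 := ltW a_gt0; have g_ge0 := ltW gamma_gt0.
apply/le_anti/andP; split.
  by apply: (splits_one_unique g_ge0 a_ge0 fg); rewrite fa.
by apply: (splits_one_unique a_ge0 g_ge0 fa); rewrite fg.
Qed.

Lemma splits_one_perron a : 0 < a -> a < 1 -> simple_poly (minpoly a) -> splits_one a ->
  perron a^-1.
Proof.
move=> a_gt0 a_lt1 a_simple fS; have a0 := lt0r_neq0 a_gt0.
split=> [||gamma' conj_g' neq_g']; first exact: splits_one_Aint.
  by rewrite invf_gt1.
have [f fa] := fS; have := conjugateV a0 conj_g'.
have : gamma'^-1 != a by apply: contraNneq neq_g' => <-; rewrite invrK.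
have g'0 : gamma' != 0 by apply: conjugate_neq0 conj_g'; rewrite invr_eq0.
rewrite -[gamma' in X in _ -> _ -> X]invrK normfV.
have : gamma'^-1 != 0 by rewrite invr_eq0.
move: gamma'^-1 => gamma {conj_g' neq_g' g'0 gamma'} g0 neq_g conj_g.
rewrite ltf_pV2 ?posrE ?normr_gt0 //.
have fg := splits_one_conjugate fa conj_g.
have le_a : a <= `|gamma|.
  apply: (splits_one_unique (ltW a_gt0) (normr_ge0 _) fa).
  by rewrite -[leLHS]normr1 -fg normrM ler_wpM2l ?natpoly_normr.
rewrite lt_neqAle le_a andbT; apply: contraNneq neq_g => norm_g.
have f0 : (0 < size f)%N.
  by rewrite size_poly_gt0 (splits_one_neq0 fa).
have lt_f : ((size f).-1 < size f)%N by rewrite prednK.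
have expand (x : algC) : x * (natpoly algC f).[x] = \sum_(i < size f) (f`_i)%R%:R * x ^+ i.+1.
  by rewrite horner_natpoly mulr_sumr; apply: eq_bigr => i _; rewrite mulrCA -exprS.
apply/eqP; apply: (@conjugate_circle_simple a gamma (size f)) => //.
(* Both sums equal 1 while their terms have the same moduli, so the terms agree one by one; the top
   one, with nonzero coefficient, gives equal powers of exponent [size f]. *)
have := @normC_sum_upper algC _ xpredT (fun i : 'I_(size f) => (f`_i)%R%:R * gamma ^+ i.+1)
  (fun i => (f`_i)%R%:R * a ^+ i.+1).
rewrite -!expand fa fg => /(_ _ erefl (Ordinal lt_f) isT) /=.
rewrite prednK // => eq_term; apply: (mulfI _ (eq_term _)) => [|i _].
  by rewrite pnatr_eq0 -lead_coefE lead_coef_eq0 -size_poly_gt0.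
by rewrite normrM normrX normr_nat norm_g.
Qed.

(** * Divisibility in M_alpha *)

Section MonoidFacts.
Variable M : nmodType.
Implicit Types a b c : M.

Lemma mdvd_refl a : mdvd a a.
Proof. by exists 0; rewrite addr0. Qed.

Lemma mdvd_trans a b c : mdvd a b -> mdvd b c -> mdvd a c.
Proof. by case=> x -> [y ->]; exists (x + y); rewrite addrA. Qed.

Lemma valuation_min (S : set M) : valuation_monoid M -> finite_set S ->
  (S !=set0)%classic -> exists2 g, S g & forall s, S s -> mdvd g s.
Proof.
move=> M_val /finite_seqP[s ->] [x /= xs].
elim: s x xs => [//|y [|z s] IHs] x xs.
  by exists y => [|w] /=; rewrite mem_seq1 // => /eqP->; apply: mdvd_refl.
have [g gs g_min] := IHs z (mem_head _ _).
have [yg|gy] := M_val y g.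
  exists y => [|w] /=; first exact: mem_head.
  by rewrite inE => /predU1P[->|/g_min]; [apply: mdvd_refl | apply: mdvd_trans].
exists g => [|w] /=; first by rewrite inE gs orbT.
by rewrite inE => /predU1P[->|/g_min].
Qed.

End MonoidFacts.

Section GcdMonoids.
Variable M : nmodType.
Implicit Types (S : set M).

Lemma valuation_gcd : valuation_monoid M -> gcd_monoid M.
Proof.
move=> M_val S S_fin S_ne; have [g Sg g_min] := valuation_min M_val S_fin S_ne.
by exists g; split=> // d; apply.
Qed.

(** The gcd is formed componentwise: in each factor some member of the finite image of S divides all
    the others. *)
Lemma dprod_valuation_gcd (I : Type) (N : I -> nmodType) :
  (forall i, valuation_monoid (N i)) -> isom_dprod M N -> gcd_monoid M.
Proof.
move=> N_val [f [[g fK gK] f_add]] S S_fin S_ne.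
have fD i x y : f (x + y) i = f x i + f y i by case: (f_add i) => _; apply.
have f_inj : injective f := can_inj fK.
have /all_sig2[h h_in h_min] (i : I) :
    {c | exists2 s, S s & f s i = c & forall s, S s -> mdvd c (f s i)}.
  apply: cid2; have [||c [s Ss <-] c_min] :=
    @valuation_min _ ((fun x => f x i) @` S)%classic (N_val i).
  - exact: finite_image.
  - by case: S_ne => s Ss; exists (f s i), s.
  exists (f s i) => [|y Sy]; first by exists s.
  by apply: c_min; exists y.
exists (g h); split=> [s Ss|d d_dvd].
  have /all_sig[c defc] (i : I) : {c | f s i = h i + c}.
    by apply: cid; apply: h_min.
  exists (g c); apply: f_inj; apply: functional_extensionality_dep => i.
  by rewrite fD !gK.
have /all_sig[c defc] (i : I) : {c | h i = f d i + c}.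
  apply: cid; have [s Ss <-] := h_in i; have [c ->] := d_dvd s Ss.
  by exists (f c i).
exists (g c); apply: f_inj; apply: functional_extensionality_dep => i.
by rewrite fD !gK.
Qed.

End GcdMonoids.

Lemma MpredP alpha (x : algC) :
  reflect (exists p : {poly nat}, x = (natpoly algC p).[alpha]) (x \in Mpred alpha).
Proof. exact: asboolP. Qed.

Lemma Mmon_of_subproof alpha (p : {poly nat}) : (natpoly algC p).[alpha] \in Mpred alpha.
Proof. by apply/MpredP; exists p. Qed.

Definition Mmon_of alpha p : Mmon alpha :=
  exist (fun x => x \in Mpred alpha) _ (Mmon_of_subproof alpha p).

Lemma val_Mmon_of alpha p : val (Mmon_of alpha p) = (natpoly algC p).[alpha].
Proof. by []. Qed.

Lemma Mmon_ofP alpha (x : Mmon alpha) : exists p, x = Mmon_of alpha p.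
Proof. by have /MpredP[p defx] := valP x; exists p; apply: val_inj. Qed.

Lemma Mmon_ofD alpha p q : Mmon_of alpha (p + q) = Mmon_of alpha p + Mmon_of alpha q.
Proof. by apply: val_inj; rewrite /= natpolyD hornerD. Qed.

Lemma Mmon_of0 alpha : Mmon_of alpha 0 = 0.
Proof. by apply: val_inj; rewrite /= natpoly0 horner0. Qed.

Lemma Mmon_addI alpha (x y z : Mmon alpha) : x + y = x + z -> y = z.
Proof. by move=> /(congr1 val)/addrI/val_inj. Qed.

Lemma natpoly_pick (p : {poly nat}) k : p`_k != 0 -> exists r, p = 'X^k + r.
Proof.
move=> pk; exists (\poly_(i < size p) ((p`_i)%R - (i == k))%N).
apply/polyP=> i; rewrite coefD coefXn coef_poly.
have [->|_] := eqVneq i k.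
  case: ltnP => [_|lek]; last by rewrite nth_default ?eqxx in pk.
  by move: pk; case: (p`_k) => // n _; rewrite subn1.
by rewrite subn0; case: ltnP => // lei; rewrite nth_default.
Qed.

(** * Atoms of M_alpha *)

Section Positive.
Variable alpha : algC.
Hypotheses (alpha_gt0 : 0 < alpha) (alpha_lt1 : alpha < 1).

Lemma Mmon_of_eq0 p : Mmon_of alpha p = 0 -> p = 0.
Proof.
move=> /(congr1 val) /= p0; apply/eqP; apply: contra_eqT p0 => p0.
by rewrite gt_eqF // natpoly_gt0.
Qed.

Lemma minvertible_Mmon (x : Mmon alpha) : minvertible x -> x = 0.
Proof.
have [p ->] := Mmon_ofP x; case=> y; have [q ->] := Mmon_ofP y.
rewrite -Mmon_ofD => /Mmon_of_eq0 pq0; rewrite -(Mmon_of0 alpha); congr Mmon_of.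
apply/polyP=> i; apply/eqP; have /(congr1 (fun p : {poly nat} => p`_i)) := pq0.
by rewrite coefD !coef0 => /eqP; rewrite addn_eq0 => /andP[].
Qed.

(** As alpha < 1, a term alpha^i with i <= k is at least alpha^k, and the other summand is positive;
    so p and q have no such term. Hence x^(k+1) divides p + q, and cancelling alpha^k leaves the
    relation. *)
Lemma power_split k (p q : {poly nat}) : p != 0 -> q != 0 ->
  alpha ^+ k = (natpoly algC p).[alpha] + (natpoly algC q).[alpha] -> splits_one alpha.
Proof.
move=> p0 q0 defk.
have low (u v : {poly nat}) i : v != 0 ->
    alpha ^+ k = (natpoly algC u).[alpha] + (natpoly algC v).[alpha] ->
    (i <= k)%N -> u`_i = 0.
  move=> v0 defk' le_ik; apply/eqP; apply: contraT => ui.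
  have le_u := natpoly_ge_term (ltW alpha_gt0) ui.
  have: alpha ^+ k <= (natpoly algC u).[alpha].
    by rewrite (le_trans _ le_u) // ler_wiXn2l // ltW.
  by rewrite defk' gerDl lt_geF // natpoly_gt0.
pose s : {poly nat} := p + q; pose f : {poly nat} := drop_poly k.+1 s.
have defs : s = f * 'X^(k.+1).
  rewrite -[LHS](poly_take_drop k.+1) [take_poly _ _](_ : _ = 0) ?add0r //.
  apply/polyP=> i; rewrite coef_take_poly coef0; case: ltnP => // le_ik.
  by rewrite coefD (low p q) // (low q p) // addrC.
exists f; apply: (mulfI (expf_neq0 k (lt0r_neq0 alpha_gt0))).
rewrite mulr1 [RHS]defk -hornerD -natpolyD -/s defs natpolyM natpoly_Xn.
rewrite hornerM hornerXn mulrA -exprSr.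
exact: mulrC.
Qed.

Lemma antimatter_splits : antimatter (Mmon alpha) -> splits_one alpha.
Proof.
move=> no_atom; apply: contrapT => no_split; apply: no_atom.
exists (Mmon_of alpha 1); split=> [/minvertible_Mmon/Mmon_of_eq0/eqP|b c].
  by rewrite oner_eq0.
have [p ->] := Mmon_ofP b; have [q ->] := Mmon_ofP c => /(congr1 val) /= def1.
have [->|p0] := eqVneq p 0; first by left; exists 0; rewrite Mmon_of0 addr0.
have [->|q0] := eqVneq q 0; first by right; exists 0; rewrite Mmon_of0 addr0.
case: no_split; apply: (@power_split 0 p q) => //; rewrite expr0 -def1.
by rewrite natpoly1 hornerE.
Qed.

(** A sum of two or more powers is visibly decomposable. A lone alpha^k equals alpha^(k+1) f(alpha),
    where f is not a single power since the powers of alpha are distinct. *)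
Lemma splits_antimatter : splits_one alpha -> antimatter (Mmon alpha).
Proof.
case=> f fa [a]; have [p ->] := Mmon_ofP a; case=> a_ninv a_split.
have p0 : p != 0.
  by apply: contra_not_neq a_ninv => ->; exists 0; rewrite Mmon_of0 addr0.
have proper (u v : {poly nat}) : u != 0 -> v != 0 ->
    (natpoly algC p).[alpha] = (natpoly algC u).[alpha] + (natpoly algC v).[alpha] -> False.
  move=> u0 v0 defp; have [||] := a_split (Mmon_of alpha u) (Mmon_of alpha v).
  - exact: val_inj.
  - by move/minvertible_Mmon/Mmon_of_eq0/eqP; rewrite (negPf u0).
  - by move/minvertible_Mmon/Mmon_of_eq0/eqP; rewrite (negPf v0).
have Xn0 n : 'X^n != 0 :> {poly nat} by rewrite -size_poly_gt0 size_polyXn.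
have [k pk] : exists k, p`_k != 0 by exists (size p).-1; rewrite -lead_coefE lead_coef_eq0.
have [j fj] : exists j, f`_j != 0 
  by exists (size f).-1; rewrite -lead_coefE lead_coef_eq0 (splits_one_neq0 fa).
have [r defp] := natpoly_pick pk; have [s deff] := natpoly_pick fj.
have [r0|r0] := eqVneq r 0; last first.
  by apply: (proper 'X^k r) => //; rewrite defp natpolyD hornerD.
have defpa : (natpoly algC p).[alpha] =
    alpha ^+ (k + j.+1) + alpha ^+ k.+1 * (natpoly algC s).[alpha].
  rewrite defp r0 addr0 natpoly_Xn hornerXn -[LHS]mulr1 -fa deff.
  rewrite natpolyD hornerD natpoly_Xn hornerXn.
  by rewrite exprD !exprS; ring.
have [s0|s0] := eqVneq s 0.
  move: defpa; rewrite defp r0 s0 addr0 natpoly_Xn hornerXn.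
  rewrite natpoly0 horner0 mulr0 addr0 => /(ieexprIn alpha_gt0).
  by rewrite lt_eqF // => /(_ isT) /eqP; rewrite -{1}[k]addn0 eqn_add2l.
apply: (proper 'X^(k + j.+1) ('X^(k.+1) * s)) => //.
  rewrite -natpoly_neq0 natpolyM mulf_neq0 ?natpoly_neq0 ?Xn0 //.
rewrite defpa natpoly_Xn hornerXn natpolyM hornerM.
by rewrite natpoly_Xn hornerXn.
Qed.

End Positive.

Lemma Mmon_of_sum alpha (p : {poly nat}) :
  Mmon_of alpha p = \sum_(i < size p) Mmon_of alpha 'X^i *+ (p`_i)%R.
Proof.
have ofMn q n : Mmon_of alpha (q *+ n) = Mmon_of alpha q *+ n.
  by elim: n => [|n IHn]; rewrite ?Mmon_of0 // !mulrS Mmon_ofD IHn.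
rewrite -{1}[p]coefK poly_def.
rewrite (big_morph _ (Mmon_ofD alpha) (Mmon_of0 alpha)).
apply: eq_bigr => i _; rewrite -ofMn; congr Mmon_of.
by apply/polyP=> j; rewrite coefZ coefMn -mulr_natr mulrC natn.
Qed.

(** * GCD monoids *)

Section GcdAntimatter.
Variable alpha : algC.
Hypotheses (alpha_gt0 : 0 < alpha) (alpha_lt1 : alpha < 1).

(** These are the positive and negative parts of an integral multiple of [minpoly alpha]. *)
Lemma natpoly_integer_relation : exists p q : {poly nat},
  [/\ q != 0, (natpoly algC p).[alpha] = (natpoly algC q).[alpha]
    & forall i, p`_i = 0 \/ q`_i = 0].
Proof.
have [z [c c0 defm]] := rat_poly_scale (minpoly alpha).
have z0 : z != 0.
  apply: contraNneq (minpoly_neq0 alpha) => z0.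
  by rewrite defm z0 rmorph0 scaler0.
have za : (map_poly intr z : {poly algC}).[alpha] = 0.
  have /eqP := root_minCpoly alpha; rewrite minCpolyE defm map_polyZ hornerZ /=.
  move/eqP; rewrite mulf_eq0 fmorph_eq0 invr_eq0 intr_eq0 (negPf c0) /= => /eqP <-.
  rewrite -map_poly_comp; congr _.[_]; apply: eq_map_poly => x /=.
  by rewrite ratr_int.
pose p : {poly nat} := \poly_(i < size z) (if 0 <= z`_i then `|(z`_i)%R|%N else 0%N).
pose q : {poly nat} := \poly_(i < size z) (if 0 <= z`_i then 0%N else `|(z`_i)%R|%N).
have defz : natpoly algC p - natpoly algC q = map_poly intr z.
  apply/polyP=> i; rewrite coefB !coef_natpoly coef_map !coef_poly /=.
  case: ltnP => [_|lei]; last by rewrite nth_default ?subr0.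
  case: ifP => [z_ge0|/negbT]; first by rewrite subr0 natr_absz ger0_norm.
  by rewrite -ltNge => z_lt0; rewrite sub0r natr_absz ltr0_norm // rmorphN opprK.
have pq : (natpoly algC p).[alpha] = (natpoly algC q).[alpha].
  by apply/eqP; rewrite -subr_eq0 -hornerN -hornerD defz za.
exists p, q; split=> // [|i].
  apply: contraNneq z0 => q0; have p0 : p = 0.
    apply/eqP; apply: contra_eqT pq => p0.
    by rewrite q0 natpoly0 horner0 gt_eqF // natpoly_gt0.
  apply/eqP/polyP=> i; apply: (@intr_inj algC).
  by rewrite -coef_map -defz p0 q0 natpoly0 subrr !coef0.
by rewrite !coef_poly; case: ltnP; [case: ifP; auto | left].
Qed.

Lemma gcd_splits : gcd_monoid (Mmon alpha) -> splits_one alpha.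
Proof.
move=> M_gcd; apply: contrapT => no_split.
pose e k : Mmon alpha := Mmon_of alpha 'X^k.
have e_val k : val (e k) = alpha ^+ k by rewrite val_Mmon_of natpoly_Xn hornerXn.
have e_irr k (x y : Mmon alpha) : e k = x + y -> x = 0 \/ y = 0.
  have [p ->] := Mmon_ofP x; have [q ->] := Mmon_ofP y => /(congr1 val).
  rewrite e_val /= => defk.
  have [->|p0] := eqVneq p 0; first by left; rewrite Mmon_of0.
  have [->|q0] := eqVneq q 0; first by right; rewrite Mmon_of0.
  by case: no_split; apply: (@power_split _ _ _ k p q).
have e0 k : e k <> 0.
  move/(congr1 val); rewrite e_val /= => /eqP.
  by rewrite expf_eq0 (gt_eqF alpha_gt0) andbF.
have e_prime k x y : mdvd (e k) (x + y) -> mdvd (e k) x \/ mdvd (e k) y.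
  move=> ek_dvd.
  (* gcd(e k + y, x + y) = gcd(e k, x) + y. *)
  have [||g [g_dvd g_max]] := M_gcd [set e k + y; x + y]%classic.
  - exact: finite_set2.
  - by exists (x + y); right.
  have [h defg] : mdvd y g.
    by apply: g_max => _ [->|->]; [exists (e k) | exists x]; rewrite addrC.
  have [h1 /eqP] := g_dvd (e k + y) (or_introl erefl).
  have [h2 /eqP] := g_dvd (x + y) (or_intror erefl).
  rewrite defg ![_ + y]addrC -!addrA => /eqP/Mmon_addI defx /eqP/Mmon_addI defe.
  (* Now e k = h + h1 and x = h + h2. If h1 = 0, then e k = h divides x; if h = 0, the gcd is y, and
     e k divides it. *)
  have [h0|h10] := e_irr k _ _ defe; last first.
    by left; exists h2; rewrite defx defe h10 addr0.
  have : mdvd (e k) g.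
    by apply: g_max => _ [->|->] //; exists y.
  by rewrite defg h0 addr0; right.
have e_sum k (p : {poly nat}) : mdvd (e k) (Mmon_of alpha p) ->
    exists2 i, p`_i != 0 & mdvd (e k) (e i).
  apply: contraPP => no_i; rewrite Mmon_of_sum.
  have ek0 : ~ mdvd (e k) 0.
    case=> c /esym; have [q ->] := Mmon_ofP c; rewrite -Mmon_ofD.
    move=> /(Mmon_of_eq0 alpha_gt0) /(congr1 (fun p : {poly nat} => p`_k)).
    by rewrite coefD coefXn eqxx coef0.
  apply: (big_ind (fun x => ~ mdvd (e k) x)) => // [x y ndx ndy /e_prime[]//|i _].
  have [->|pi] := eqVneq p`_i 0%N; first by rewrite mulr0n.
  elim: (p`_i) => [|n IHn]; first by rewrite mulr0n.
  rewrite mulrS => /e_prime[ek_dvd|/IHn//]; apply: no_i.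
  by exists i.
have [p [q [q0 pq disj]]] := natpoly_integer_relation.
have qk : q`_(size q).-1 != 0 by rewrite -lead_coefE lead_coef_eq0.
(* For k in the support of q, e k divides q(alpha) = p(alpha), hence some e i with i in the support
   of p. Irreducibility of e i forces i = k, against disjointness. *)
move: (size q).-1 qk => k qk; have [r defq] := natpoly_pick qk.
have : mdvd (e k) (Mmon_of alpha p).
  exists (Mmon_of alpha r); rewrite -Mmon_ofD -defq; exact: val_inj.
case/e_sum=> i pi [c ei]; have [/e0//|c0] := e_irr i _ _ ei.
have [p0|q0'] := disj k; last by rewrite q0' eqxx in qk.
move: pi; suff -> : i = k by rewrite p0 eqxx.
apply: (ieexprIn alpha_gt0); first by rewrite lt_eqF.
by rewrite -!e_val ei c0 addr0.
Qed.

End GcdAntimatter.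

(** * Valuation monoids and simplicity *)

(** Divisibility is the order of the reals: a positive difference of two elements is, up to a power
    of alpha, w(1/alpha) for an integral w, so [perron_representation] puts it in M_alpha. *)
Lemma perron_valuation (alpha : algC) : 0 < alpha -> perron alpha^-1 ->
  no_other_positive_conjugate alpha^-1 -> valuation_monoid (Mmon alpha).
Proof.
move=> alpha_gt0 b_perron b_pos.
have alpha0 : alpha != 0 by rewrite gt_eqF.
have diff (p q : {poly nat}) :
    (natpoly algC q).[alpha] < (natpoly algC p).[alpha] ->
  mdvd (Mmon_of alpha q) (Mmon_of alpha p).
  move=> lt_qp; pose n := maxn (size p) (size q).
  pose w := revp n (natpoly int p - natpoly int q).
  have map_nat (u : {poly nat}) : map_poly intr (natpoly int u) = natpoly algC u.
    by apply/polyP=> i; rewrite coef_map /= !coef_natpoly rmorph_nat.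
  have sz_le (u : {poly nat}) : (size u <= n)%N -> (size (natpoly algC u) <= n.+1)%N.
    by move=> leu; rewrite (leq_trans (size_poly _ _)) // ltnW.
  have wb : (map_poly intr w).[alpha^-1] =
      alpha^-1 ^+ n * ((natpoly algC p).[alpha] - (natpoly algC q).[alpha]).
    rewrite -revp_map rmorphB /= !map_nat horner_revp ?invr_eq0 //.
      by rewrite invrK hornerD hornerN.
    rewrite (leq_trans (size_polyD _ _)) // geq_max size_polyN.
    by rewrite !sz_le ?leq_maxl ?leq_maxr.
  have [|D [c [szc defc _ _]]] := perron_representation b_perron b_pos (w := w).
    by rewrite wb mulr_gt0 ?exprn_gt0 ?invr_gt0 ?subr_gt0.
  exists (Mmon_of alpha (revp (D + n) c)); apply: val_inj => /=.
  rewrite -revp_natpoly horner_revp //; last first.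
    by rewrite (leq_trans (size_poly _ _)) // (leq_trans szc) // leqW // leq_addr.
  rewrite defc wb exprD !exprVn mulrACA mulfV ?expf_neq0 // mul1r.
  by rewrite mulrA mulfV ?expf_neq0 // mul1r addrC subrK.
move=> x y; have [p ->] := Mmon_ofP x; have [q ->] := Mmon_ofP y.
have realM (u : {poly nat}) : (natpoly algC u).[alpha] \is Num.real.
  by rewrite ger0_real // natpoly_ge0 // ltW.
have [lt_pq|lt_qp|eq_pq] := real_ltgtP (realM p) (realM q).
- by left; apply: diff.
- by right; apply: diff.
by left; exists 0; rewrite addr0; apply: val_inj.
Qed.

(** In a nonzero class mod k, the section of s - 1 is that of s. It vanishes at the positive number
    alpha^k, and its coefficients are nonnegative, so it is zero. *)
Lemma supp_comp_dvdn alpha k (s : {poly nat}) : 0 < alpha -> (0 < k)%N ->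
    (forall i, (minpoly alpha)`_i != 0 -> (k %| i)%N) ->
    (natpoly algC s).[alpha] = 1 ->
  forall i, s`_i != 0 -> (k %| i)%N.
Proof.
move=> alpha_gt0 k_gt0 /(comp_psect0 k_gt0) defm s1 i.
apply: contraNT => ndvd; have r_gt0 : (0 < i %% k)%N by rewrite lt0n.
have psect1 : psect k (i %% k) (1 : {poly rat}) = 0.
  apply/polyP=> j; rewrite coef_psect // coef1 coef0 addn_eq0.
  by rewrite (gtn_eqF r_gt0) andbF.
have : (map_poly ratr (psect k (i %% k) (natpoly rat s - 1))).[alpha ^+ k] = 0.
  apply: (horner_psect _ defm); first by rewrite ltn_pmod.
  by rewrite rmorphB rmorph1 /= map_ratr_natpoly !hornerE s1 subrr.
have -> : psect k (i %% k) (natpoly rat s - 1) = natpoly rat (psect k (i %% k) s).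
  rewrite -psect_natpoly //; apply/polyP=> j.
  have /(congr1 (fun p : {poly rat} => p`_j)) := psect1.
  by rewrite !coef_psect // coefB => ->; rewrite coef0 subr0.
rewrite map_ratr_natpoly => s0; have : psect k (i %% k) s = 0.
  apply/eqP; apply: contra_eqT s0 => s0.
  by rewrite gt_eqF // natpoly_gt0 // exprn_gt0.
move/(congr1 (fun p : {poly nat} => p`_(i %/ k))).
by rewrite coef_psect // -divn_eq coef0 => ->.
Qed.

Lemma natpoly_comp_Xn (R : nzSemiRingType) (p : {poly nat}) k : (0 < k)%N ->
  natpoly R (p \Po 'X^k) = natpoly R p \Po 'X^k.
Proof.
move=> k_gt0; apply/polyP=> i; rewrite coef_natpoly !coef_comp_poly_Xn //.
by case: ifP => //; rewrite coef_natpoly.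
Qed.

Lemma splits_one_expn alpha k : 0 < alpha -> (0 < k)%N ->
    (forall i, (minpoly alpha)`_i != 0 -> (k %| i)%N) ->
  splits_one alpha -> splits_one (alpha ^+ k).
Proof.
move=> alpha_gt0 k_gt0 m_supp [f fa]; pose s : {poly nat} := 'X * f.
have s1 : (natpoly algC s).[alpha] = 1.
  by rewrite /s natpolyM -['X]expr1 natpoly_Xn hornerM expr1 hornerX.
have defs := comp_psect0 k_gt0 (supp_comp_dvdn alpha_gt0 k_gt0 m_supp s1).
pose t := psect k 0 s; exists (drop_poly 1 t).
have t1 : (natpoly algC t).[alpha ^+ k] = 1.
  by rewrite -s1 [in RHS]defs natpoly_comp_Xn // horner_comp_Xn.
rewrite -[RHS]t1 -[in RHS](poly_take_drop 1 t) (_ : take_poly 1 t = 0); last first.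
  apply/polyP=> -[|i]; rewrite coef_take_poly coef0 // coef_psect //.
  by rewrite coefXM.
by rewrite add0r natpolyM natpoly_Xn hornerM hornerXn expr1 mulrC.
Qed.

(** Comparing 1 and alpha gives 1 = alpha + f(alpha). The exponent 1 occurs in x + f, so
    [supp_comp_dvdn] makes k divide 1. *)
Lemma valuation_simple alpha : 0 < alpha -> alpha < 1 ->
  valuation_monoid (Mmon alpha) -> simple_Mmon alpha.
Proof.
move=> alpha_gt0 alpha_lt1 M_val; apply/simple_polyP.
split=> [|k k_gt0 m_supp]; first exact: size_minpoly.
have [[c]|[c]] := M_val (Mmon_of alpha 1) (Mmon_of alpha 'X).
  have [f ->] := Mmon_ofP c => /(congr1 val) /=.
  rewrite -['X]expr1 natpoly_Xn natpoly1 hornerXn expr1 hornerC => def_a.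
  move: alpha_lt1; rewrite {1}def_a gtrDl.
  by rewrite (le_gtF (natpoly_ge0 f (ltW alpha_gt0))).
have [f ->] := Mmon_ofP c => /(congr1 val); rewrite -Mmon_ofD /= natpoly1 hornerC.
move=> /esym/(supp_comp_dvdn alpha_gt0 k_gt0 m_supp)/(_ 1%N).
rewrite coefD coefX /= dvdn1 => /(_ isT)/eqP //.
Qed.

Lemma splits_simple_minpoly alpha n : 0 < alpha -> simple_poly n -> in_xN0x_sub1 n ->
  (map_poly ratr n).[alpha] = 0 -> splits_one alpha /\ simple_Mmon alpha.
Proof.
move=> alpha_gt0 /simple_polyP[_ n_simple] [f defn].
rewrite defn horner_xN0x_sub1 => /eqP; rewrite subr_eq0 => /eqP fa.
split; first by exists f.
apply/simple_polyP; split=> [|k k_gt0 m_supp]; first exact: size_minpoly.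
apply: n_simple => // -[//|i]; rewrite defn coefB coef1 subr0 => ni.
apply: (supp_comp_dvdn alpha_gt0 k_gt0 m_supp (s := 'X * f)).
  by rewrite natpolyM -['X]expr1 natpoly_Xn hornerM expr1 hornerX.
by move: ni; rewrite !coefXM coef_natpoly /= pnatr_eq0.
Qed.

(** The case w = 1 of [perron_representation]. The consecutive exponents d and d + 1 of f will make
    x f - 1 simple. *)
Lemma perron_splits beta : perron beta -> no_other_positive_conjugate beta ->
  exists f : {poly nat}, exists d : nat,
    [/\ beta^-1 * (natpoly algC f).[beta^-1] = 1, f`_d.+1 != 0 & f`_d != 0].
Proof.
move=> b_perron b_pos; have [_ b_gt1 _] := b_perron.
have b0 : beta != 0 by rewrite gt_eqF // (lt_trans ltr01).
have [|D [c [szc defc c0 c1]]] := perron_representation b_perron b_pos (w := 1).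
  by rewrite rmorph1 hornerC ltr01.
have szc2 : (1 < size c)%N.
  by rewrite ltnNge; apply: contraTN c1 => lec; rewrite nth_default.
have [d defD] : exists d, D = d.+2.
  by exists D.-2; move: (leq_trans szc2 szc); case: (D) => [|[]].
(* Reversing at D - 1 = d + 1 leaves one factor 1/beta over and moves the coefficients 0 and 1 of c
   to d + 1 and d. *)
exists (revp d.+1 c), d; split.
- rewrite -revp_natpoly horner_revp ?invr_eq0 //; last first.
    by rewrite (leq_trans (size_poly _ _)) // -defD.
  rewrite invrK defc rmorph1 hornerC mulr1 mulrA -exprS -defD exprVn.
  by rewrite mulVf // expf_neq0.
- by rewrite coef_poly ltnSn subnn -lt0n.
by rewrite coef_poly ltnW // subSnn -lt0n.
Qed.

(** * Decomposition of M_alpha as a power *)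

Lemma Mmon_isom alpha k : (0 < k)%N ->
    (forall i, (minpoly alpha)`_i != 0 -> (k %| i)%N) ->
  isom_dprod (Mmon alpha) (fun _ : 'I_k => Mmon (alpha ^+ k) : nmodType).
Proof.
move=> k_gt0 /(comp_psect0 k_gt0) defm.
have horner_split (p : {poly nat}) : (natpoly algC p).[alpha] =
    \sum_(r < k) alpha ^+ r * (natpoly algC (psect k r p)).[alpha ^+ k].
  rewrite [LHS](congr1 (fun q => q.[alpha]) (psect_split k_gt0 (natpoly algC p))).
  rewrite horner_sum; apply: eq_bigr => r _.
  by rewrite hornerM hornerXn horner_comp_Xn psect_natpoly.
pose P (x : Mmon alpha) : {poly nat} := projT1 (cid (Mmon_ofP x)).
have PK x : Mmon_of alpha (P x) = x by rewrite /P; case: cid.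
pose f (x : Mmon alpha) (r : 'I_k) := Mmon_of (alpha ^+ k) (psect k r (P x)).
(* The components do not depend on the chosen representative, by [horner_psect] applied to the
   difference of two of them. *)
have f_of p (r : 'I_k) : f (Mmon_of alpha p) r = Mmon_of (alpha ^+ k) (psect k r p).
  apply: val_inj => /=; set q := P _.
  have /(congr1 val) /= pq : Mmon_of alpha q = Mmon_of alpha p := PK _.
  have := @horner_psect alpha _ k r (natpoly rat q - natpoly rat p) (ltn_ord r) defm.
  rewrite rmorphB /= !map_ratr_natpoly hornerD hornerN pq subrr => /(_ erefl) /eqP.
  have -> : psect k r (natpoly rat q - natpoly rat p) =
      natpoly rat (psect k r q) - natpoly rat (psect k r p).
    by apply/polyP=> i; rewrite -!psect_natpoly // coefB !coef_psect // coefB.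
  rewrite rmorphB /= !map_ratr_natpoly hornerD hornerN subr_eq0.
  by move/eqP.
have f_inj : injective f.
  move=> x y fxy; rewrite -(PK x) -(PK y); apply: val_inj => /=.
  rewrite !horner_split; apply: eq_bigr => r _; congr (_ * _).
  by have /(congr1 (fun g : 'I_k -> Mmon (alpha ^+ k) => val (g r))) := fxy.
have f_surj (y : 'I_k -> Mmon (alpha ^+ k)) : exists x, f x = y.
  have [Q defy] := choice (fun r => Mmon_ofP (y r)).
  exists (Mmon_of alpha (\sum_(r < k) (Q r \Po 'X^k) * 'X^r)).
  apply: funext => r; rewrite f_of defy; congr Mmon_of.
  apply/polyP=> i; rewrite coef_psect // coef_sum (bigD1 r) //= big1 => [|j j_neq].
    rewrite addr0 coefMXn ltnNge leq_addl /= addnK coef_comp_poly_Xn //.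
    by rewrite dvdn_mull // mulnK.
  rewrite coefMXn; case: ltnP => // le_j; rewrite coef_comp_poly_Xn //.
  case: ifP => // /dvdnP[l defl]; case/eqP: j_neq; apply: val_inj => /=.
  rewrite -(modn_small (ltn_ord j)) -(modn_small (ltn_ord r)).
  by rewrite -(modnMDl i r) -(subnK le_j) defl modnMDl.
have [g gK] := choice f_surj.
exists f; split=> [|r].
  by exists g => [x|y]; [apply: f_inj; rewrite gK | rewrite gK].
split=> [|x y].
  rewrite -Mmon_of0 f_of -Mmon_of0; congr Mmon_of.
  by apply/polyP=> i; rewrite coef_psect // !coef0.
rewrite -(PK x) -(PK y) -Mmon_ofD !f_of -Mmon_ofD; congr Mmon_of.
by apply/polyP=> i; rewrite coefD !coef_psect // coefD.
Qed.

Lemma splits_oneP alpha :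
  splits_one alpha <->
  exists n : {poly rat}, in_xN0x_sub1 n /\ (map_poly ratr n).[alpha] = 0.
Proof.
split=> [[f fa]|[n [[f ->]]]]; last first.
  by rewrite horner_xN0x_sub1 => /eqP; rewrite subr_eq0 => /eqP fa; exists f.
exists ('X * natpoly rat f - 1); split; first by exists f.
by rewrite horner_xN0x_sub1 fa subrr.
Qed.

Lemma no_other_positive_conjugateV a : a != 0 -> no_other_positive_conjugate a ->
  no_other_positive_conjugate a^-1.
Proof.
move=> a0 a_pos gamma conj_g gamma_gt0.
by rewrite -[gamma]invrK (a_pos gamma^-1) ?conjugateV ?invr_gt0.
Qed.

Lemma perron_simple_poly alpha : alpha != 0 -> perron alpha^-1 ->
  no_other_positive_conjugate alpha^-1 ->
  exists n : {poly rat},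
    [/\ simple_poly n, in_xN0x_sub1 n & (map_poly ratr n).[alpha] = 0].
Proof.
move=> alpha0 b_perron b_pos.
have [f [d [fa fd1 fd]]] := perron_splits b_perron b_pos; rewrite invrK in fa.
pose n := 'X * natpoly rat f - 1; have nE i : n`_i.+1 = (f`_i)%R%:R.
  by rewrite coefB coef1 subr0 coefXM coef_natpoly.
exists n; split; [|by exists f|by rewrite horner_xN0x_sub1 fa subrr].
apply/simple_polyP; split=> [|k k_gt0 n_supp].
  rewrite ltnNge; apply/negP=> szn; move: fd; rewrite -(pnatr_eq0 rat) -nE.
  by rewrite nth_default ?eqxx // (leq_trans szn).
have := n_supp d.+2; have := n_supp d.+1; rewrite !nE !pnatr_eq0.
move=> /(_ fd) kd /(_ fd1); rewrite -[d.+2]addn1 dvdn_addr // dvdn1.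
by move/eqP.
Qed.

(** * Simplified reciprocals and reduction to a power of alpha *)

Section Reciprocal.
Variables (h : {poly rat}) (k : nat).
Hypotheses (k_gt0 : (0 < k)%N) (h_simple : simple_poly h) (h0 : h`_0 != 0).

(** Reversal sends the exponent i to d - i. As h has a constant term, d is an exponent of the
    reversal, so a common divisor of its exponents also divides those of h. *)
Lemma simplified_reciprocal : simplified (reciprocal (h \Po 'X^k)) (reciprocal h).
Proof.
have [szh h_supp] := (simple_polyP _).1 h_simple.
have szh0 : (0 < size h)%N := ltnW szh.
have hn0 : h != 0 by rewrite -size_poly_gt0.
pose d := (size h).-1; have szd : size h = d.+1 by rewrite /d prednK.
have revE i : (reciprocal h)`_i = if (i <= d)%N then h`_(d - i) else 0.
  by rewrite reciprocalE // coef_poly ltnS.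
have szc : (size (h \Po 'X^k)).-1 = (d * k)%N by rewrite size_comp_poly size_polyXn.
have hk0 : h \Po 'X^k != 0.
  by apply: contraNneq h0 => hk0; rewrite -(psect_comp k_gt0 h) hk0 coef_psect // coef0.
split.
  apply/simple_polyP; split=> [|n n_gt0 n_supp].
    rewrite ltnNge; apply/negP=> szr.
    have : (reciprocal h)`_d = 0.
      by rewrite nth_default // (leq_trans szr) // -ltnS -szd.
    by rewrite revE leqnn subnn => /eqP; rewrite (negPf h0).
  apply: h_supp => // i hi.
  have le_id : (i <= d)%N.
    by rewrite -ltnS -szd ltnNge; apply: contraNN hi => lei; rewrite nth_default.
  have nd : (n %| d)%N by apply: n_supp; rewrite revE leqnn subnn.
  have : (n %| d - i)%N by apply: n_supp; rewrite revE leq_subr subKn.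
  by rewrite dvdn_subr.
exists k; split=> //; apply/polyP=> i.
rewrite reciprocalE // szc coef_comp_poly_Xn // revE coef_poly ltnS.
case: (leqP i (d * k)) => [le_i|gt_i]; last first.
  case: ifP => // /divnK defi; case: ifP => // le_id.
  by move: gt_i; rewrite -defi ltn_pmul2r // ltnNge le_id.
rewrite coef_comp_poly_Xn // dvdn_subr ?dvdn_mull //.
case: ifP => // /divnK defi; rewrite -{1}defi -mulnBl mulnK //.
by move: le_i; rewrite -{1}defi leq_pmul2r // => ->.
Qed.

End Reciprocal.

Section Decomposition.
Variable alpha : algC.
Let k := supp_gcd (minpoly alpha).
Hypotheses (alpha_gt0 : 0 < alpha) (alpha_lt1 : alpha < 1).
Hypothesis alpha_splits : splits_one alpha.

Lemma supp_gcd_minpoly_gt0 : (0 < k)%N.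
Proof. exact: supp_gcd_gt0 (size_minpoly alpha). Qed.

Lemma splits_perron_expn : perron (alpha ^+ k)^-1.
Proof.
have k_gt0 := supp_gcd_minpoly_gt0.
have [defm h_simple] := comp_supp_gcd (size_minpoly alpha).
apply: splits_one_perron; rewrite ?exprn_gt0 ?exprn_ilt1 ?ltW // -?lt0n //.
  by rewrite (minpoly_expn k_gt0 defm).
by apply: splits_one_expn => // i; apply: supp_gcd_dvdn.
Qed.

Lemma splits_valuation_expn : valuation_monoid (Mmon (alpha ^+ k)).
Proof.
have k_gt0 := supp_gcd_minpoly_gt0.
have a_gt0 : 0 < alpha ^+ k by rewrite exprn_gt0.
apply: perron_valuation => //; first exact: splits_perron_expn.
apply: no_other_positive_conjugateV; first by rewrite gt_eqF.
apply: splits_one_no_other_positive => //.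
by apply: splits_one_expn => // i; apply: supp_gcd_dvdn.
Qed.

Lemma splits_isom :
  isom_dprod (Mmon alpha) (fun _ : 'I_k => Mmon (alpha ^+ k) : nmodType).
Proof.
by apply: Mmon_isom => [|i]; [exact: supp_gcd_minpoly_gt0 | apply: supp_gcd_dvdn].
Qed.

Lemma splits_simplified_perron : exists g : {poly rat},
  simplified (reciprocal (minpoly alpha)) g /\
  exists beta : algC, root (map_poly ratr g) beta /\ perron beta.
Proof.
have k_gt0 := supp_gcd_minpoly_gt0.
have [defm h_simple] := comp_supp_gcd (size_minpoly alpha); rewrite -/k in defm h_simple.
have a0 : alpha ^+ k != 0 by rewrite expf_neq0 ?gt_eqF.
pose h := psect k 0 (minpoly alpha).
have h_m : minpoly (alpha ^+ k) = h := minpoly_expn k_gt0 defm.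
exists (reciprocal h); split.
  rewrite defm; apply: simplified_reciprocal => //.
  by rewrite -/h -h_m minpoly_coef0.
exists (alpha ^+ k)^-1; split; last exact: splits_perron_expn.
rewrite root_reciprocal ?invr_eq0 // -h_m ?minpoly_neq0 //.
by rewrite invrK -minCpolyE root_minCpoly.
Qed.

End Decomposition.

(** The positive n-th root of a positive root of g is the inverse of a positive conjugate of alpha,
    hence 1/alpha. So beta = alpha^(-n) has no other positive conjugate. *)
Lemma simplified_perron_splits (alpha beta : algC) g : 0 < alpha ->
    no_other_positive_conjugate alpha ->
    simplified (reciprocal (minpoly alpha)) g -> root (map_poly ratr g) beta ->
  perron beta -> splits_one alpha.
Proof.
move=> alpha_gt0 a_pos [_ [n [n_gt0 defr]]] g_beta b_perron.
have root_gt0 (gamma : algC) : 0 < gamma -> root (map_poly ratr g) gamma -> gamma = alpha^-1 ^+ n.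
  move=> gamma_gt0 g_gamma; pose theta := n.-root gamma.
  have theta_gt0 : 0 < theta by rewrite rootC_gt0.
  have thetaE : theta ^+ n = gamma by rewrite rootCK.
  rewrite -thetaE; congr (_ ^+ _); rewrite -[theta]invrK; congr _^-1.
  apply: a_pos; last by rewrite invr_gt0.
  rewrite /conjugate minCpolyE -root_reciprocal ?minpoly_neq0 ?gt_eqF //.
  by rewrite defr rootE horner_ratr_comp_Xn thetaE.
have [_ b_gt1 _] := b_perron.
have betaE := root_gt0 beta (lt_trans ltr01 b_gt1) g_beta.
have [|f [_ [fa _ _]]] := perron_splits b_perron.
  move=> gamma conj_g gamma_gt0; rewrite betaE; apply: root_gt0 => //.
  by rewrite (conjugate_root _ conj_g) -root_minpoly.
(* The relation alpha^n f(alpha^n) = 1, with one factor alpha set apart. *)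
exists ('X^(n.-1) * (f \Po 'X^n)); rewrite natpolyM natpoly_Xn natpoly_comp_Xn //.
rewrite hornerM hornerXn horner_comp_Xn mulrA -exprS prednK //.
by move: fa; rewrite betaE exprVn invrK.
Qed.

(** * The two cycles of implications *)

Theorem theorem5p6 (alpha : algC) (alpha_gt0 : 0 < alpha) (alpha_lt1 : alpha < 1) :
  [<-> simple_Mmon alpha /\ antimatter (Mmon alpha);
       perron alpha^-1 /\ no_other_positive_conjugate alpha^-1;
       exists n : {poly rat},
         [/\ simple_poly n, in_xN0x_sub1 n & (map_poly ratr n).[alpha] = 0];
       valuation_monoid (Mmon alpha);
       simple_Mmon alpha /\ gcd_monoid (Mmon alpha)]
  /\
  [<-> antimatter (Mmon alpha);
       (exists g : {poly rat}, simplified (reciprocal (minpoly alpha)) g /\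
          exists beta : algC, root (map_poly ratr g) beta /\ perron beta)
       /\ no_other_positive_conjugate alpha;
       exists n : {poly rat},
         in_xN0x_sub1 n /\ (map_poly ratr n).[alpha] = 0;
       (* some direct product of valuation monoids *)
       exists (I : Type) (N : I -> nmodType),
         (forall i, valuation_monoid (N i)) /\ isom_dprod (Mmon alpha) N;
       (* the explicit decomposition as a power *)
       let n := supp_gcd (minpoly alpha) in
         valuation_monoid (Mmon (alpha ^+ n)) /\
         isom_dprod (Mmon alpha) (fun _ : 'I_n => Mmon (alpha ^+ n) : nmodType);
       gcd_monoid (Mmon alpha)].
Proof.
have alpha0 : alpha != 0 by rewrite gt_eqF.
have splits_pV (fS : splits_one alpha) : simple_Mmon alpha ->
    perron alpha^-1 /\ no_other_positive_conjugate alpha^-1.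
  move=> a_simple; split; first exact: splits_one_perron.
  by apply: no_other_positive_conjugateV => //; apply: splits_one_no_other_positive.
split; tfae.
- by case=> a_simple /(antimatter_splits alpha_gt0 alpha_lt1) /splits_pV; apply.
- by case; apply: perron_simple_poly.
- case=> n [n_simple n_form na].
  have [fS a_simple] := splits_simple_minpoly alpha_gt0 n_simple n_form na.
  by have [b_perron b_pos] := splits_pV fS a_simple; apply: perron_valuation.
- by move=> M_val; split; [apply: valuation_simple | apply: valuation_gcd].
- by case=> a_simple /(gcd_splits alpha_gt0 alpha_lt1)/splits_antimatter; split=> //; auto.
- move=> /(antimatter_splits alpha_gt0 alpha_lt1) fS.
  by split; [apply: splits_simplified_perron | apply: splits_one_no_other_positive].
- case=> [[g [g_simpl [beta [g_beta b_perron]]]] a_pos].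
  by apply/splits_oneP; apply: simplified_perron_splits g_simpl g_beta b_perron.
- move=> /splits_oneP fS; exists 'I_(supp_gcd (minpoly alpha)).
  exists (fun _ => Mmon (alpha ^+ supp_gcd (minpoly alpha)) : nmodType).
  by split=> [_|]; [apply: splits_valuation_expn | apply: splits_isom].
- case=> I [N [N_val M_isom]] n.
  (* An arbitrary product decomposition yields the explicit one through the GCD property and the
     relation alpha f(alpha) = 1. *)
  have fS : splits_one alpha by apply: gcd_splits (dprod_valuation_gcd N_val M_isom).
  by split; [apply: splits_valuation_expn | apply: splits_isom].
- by case=> M_val M_isom; apply: dprod_valuation_gcd M_isom.
by move=> /(gcd_splits alpha_gt0 alpha_lt1); apply: splits_antimatter.
Qed.
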